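(* Fix $F\in\mathcal Q$ and $L\in\mathbb N$, and let $U=(U_{\mathfrak t})_{\mathfrak t\in\mathfrak L_+}\in\mathbf H^{\mathrm{ex}}$, written as $U_{\mathfrak t}=\sum_p\frac1{p!}u^U_{(\mathfrak t,p)}\mathbf X^p+\mathcal I_{(\mathfrak t,0)}[U^R_{\mathfrak t}]$. Then $U$ is coherent to order $L$ with $F$ if and only if, for every $\mathfrak t\in\mathfrak L_+$, $$\mathbf p_{\le L}\sum_{\mathfrak l\in\mathfrak D_{\mathfrak t}}F^{\mathfrak l}_{\mathfrak t}(U)\,\Xi_{\mathfrak l}=\mathbf p_{\le L}\,U^R_{\mathfrak t}.$$
   Context: NOTATION. $\mathbb N=\{0,1,\dots\}$; $d\ge0$; $\mathfrak s\in[1,\infty)^{d+1}$; $|k|_{\mathfrak s}=\sum k_i\mathfrak s_i$, $|k|=\sum k_i$; $e_i$ unit multi-indices; multi-indices compared componentwise. $\mathbb N^A$ is identified with multisets in $A$. $\mathfrak L=\mathfrak L_-\sqcup\mathfrak L_+$ is a finite set with $|\cdot|_{\mathfrak s}:\mathfrak L\to\mathbb R$ negative on $\mathfrak L_-$, positive on $\mathfrak L_+$. $\mathcal O=\mathfrak L_+\times\mathbb N^{d+1}=\mathcal O_+\sqcup\mathcal O_-$. $\mathrm{reg}:\mathfrak L\sqcup\{\mathbf 0\}\to\mathbb R$ satisfies $\mathrm{reg}(\mathbf 0)=0$, $\mathrm{reg}(\mathfrak l)<|\mathfrak l|_{\mathfrak s}$ for $\mathfrak l\in\mathfrak L_-$,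 and $o\in\mathcal O_\pm$ iff $\pm\mathrm{reg}(o)>0$, where $\mathrm{reg}(\mathfrak t,p)=\mathrm{reg}(\mathfrak t)-|p|_{\mathfrak s}$. $\mathcal X=(\mathcal X_o)_{o\in\mathcal O}$ are coordinates on $\mathbb R^{\mathcal O}$; $\mathcal C_{\mathcal O}$ is the algebra of smooth functions of finitely many of them; $D_o=\partial/\partial\mathcal X_o$, $\partial_iG=\sum_{(\mathfrak t,p)}\mathcal X_{(\mathfrak t,p+e_i)}D_{(\mathfrak t,p)}G$ for $0\le i\le d$. $\mathscr P\subset\mathcal C_{\mathcal O}$ consists of $G=\sum_{j=1}^mG_j\mathcal X^{\alpha_j}$ with distinct finitely supported $\alpha_j\in\mathbb N^{\mathcal O}$ supported in $\mathcal O_-$ and $0\not\equiv G_j$ depending only on coordinates in $\mathcal O_+$; $\mathcal O(G_j)$ is the minimal set of coordinates on which $G_j$ depends. RULES. $\mathcal N$ is the set of finite multisets of elements of $\mathfrak L\times\mathbb N^{d+1}$. A rule $R$ maps $\mathfrak L$ to non-empty subsets of $\mathcal N$, with $R(\mathfrak l)=\{\emptyset\}$ for $\mathfrak l\in\mathfrak L_-$; normal: $M\subset N\in R(\mathfrak t)$ implies $M\in R(\mathfrak t)$; subcritical w.r.t. $\mathrm{reg}$: $\mathrm{reg}(\mathfrak t)<|\mathfrak t|_{\mathfrak s}+\inf_{N\in R(\mathfrak t)}\sum_{o\in N}\mathrm{reg}(o)$ for all $\mathfrak t\in\mathfrak L$. For a finite rooted tree $T$ with $\mathfrak t:E_T\to\mathfrak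 L$, $\mathfrak e:E_T\to\mathbb N^{d+1}$, $\mathcal N(x)$ is the multiset of $(\mathfrak t(e),\mathfrak e(e))$ over edges leaving $x$ away from the root, $\mathfrak t_x$ the type of the edge entering $x\ne\rho_T$. $T$ strongly conforms to $R$ if $\mathcal N(x)\in R(\mathfrak t_x)$ for $x\ne\rho_T$ and $\mathcal N(\rho_T)\in R(\mathfrak t)$ for some $\mathfrak t$. A contraction datum for $(\mathfrak t,N)$: a strongly conforming $S$, multisets $M(x)\in\mathcal N$ ($x\in N_S$) with $\mathcal N(\rho_S)\sqcup M(\rho_S)\in R(\mathfrak t)$, $\mathcal N(x)\sqcup M(x)\in R(\mathfrak t_x)$ for $x\neq\rho_S$, and $m\in\mathbb N^{d+1}$, such that $N$ is obtained from $\bigsqcup_xM(x)$ by adding to the second components of its elements multi-indices summing to $m$. $|S^{\mathfrak n}_{\mathfrak e}|_-=\sum_e(|\mathfrak t(e)|_{\mathfrak s}-|\mathfrak e(e)|_{\mathfrak s})+\sum_x|\mathfrak n(x)|_{\mathfrak s}$. $R$ is complete if $N\in R(\mathfrak t)$ for all contraction data with $|S^0_{\mathfrak e}|_-+|m|_{\mathfrak s}<0$. For $N\in R(\mathfrak t)$, $D(\mathfrak t,N)\subset\mathbb Z^{d+1}\oplus\mathbb Z(\mathfrak L)$ consists of $0$ and all $\sum_{e\in E_S}(\mathfrak t(e)-\mathfrak e(e))+\sum_x\mathfrak n_S(x)-m$ for contraction data for $(\mathfrak t,N)$ and $\mathfrak n_S:N_S\to\mathbb N^{d+1}$ with $|S^{\mathfrak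 n_S}_{\mathfrak e}|_-+|m|_{\mathfrak s}<0$; $D(\mathfrak t,N)=\emptyset$ if $N\notin R(\mathfrak t)$. $R$ is a fixed normal complete rule, subcritical w.r.t. $\mathrm{reg}$. TREES. $\mathcal T^{\mathrm{ex}}$ is the set of trees $T^{\mathfrak n,\mathfrak o}_{\mathfrak e}$ ($\mathfrak n:N_T\to\mathbb N^{d+1}$, $\mathfrak o:N_T\to\mathbb Z^{d+1}\oplus\mathbb Z(\mathfrak L)$) with $T$ strongly conforming, $\mathfrak n(x)=0$ if $\mathfrak t_x\in\mathfrak L_-$, $\mathfrak o(x)\in D(\mathfrak t_x,\mathcal N(x))$ for $x\ne\rho_T$ and $\mathfrak o(\rho_T)\in D(\mathfrak t,\mathcal N(\rho_T))$ for some $\mathfrak t$. $\hat{\mathfrak D}$: multisets $\hat{\mathfrak l}$ of elements of $\mathfrak L_-\times\mathbb N^{d+1}$ lying in $R(\mathfrak t)$ for some $\mathfrak t\in\mathfrak L_+$; $\mathfrak D_{\mathfrak t}=\{(\hat{\mathfrak l},\mathfrak o):\hat{\mathfrak l}\in\hat{\mathfrak D},\mathfrak o\in D(\mathfrak t,\hat{\mathfrak l})\}$, $\mathfrak D=\bigcup_{\mathfrak t\in\mathfrak L_+}\mathfrak D_{\mathfrak t}$. $\mathcal V$: finite rooted trees with node decorations $(\mathfrak m^\Xi,\mathfrak m^X)\in\mathfrak D\times\mathbb N^{d+1}$ and edge decorations in $\mathcal O$, written $\tau=\Xi_{\mathfrak l}\mathbf X^k\prod_i\mathcal I_{o_i}[\tau_i]$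 (root decoration $(\mathfrak l,k)$, $\tau_i$ attached to the root by an $o_i$-edge). $\mathcal T^{\mathrm{ex}}\subset\mathcal V$ by removing edges of type in $\mathfrak L_-$ and recording at $x$ the driver $(\hat{\mathfrak l}(x),\mathfrak o(x))$ ($\hat{\mathfrak l}(x)$ the multiset of $(\mathfrak t(e),\mathfrak e(e))$ of removed edges leaving $x$) and $\mathfrak m^X=\mathfrak n$. $\Xi_{\mathbf 0}=\mathbf 1$ is the trivial tree. Inner product $\langle\tau,\bar\tau\rangle=\delta_{\tau,\bar\tau}S(\tau)$, $S(\Xi_{\mathfrak l}\mathbf X^k\prod_j\mathcal I_{o_j}[\tau_j]^{\beta_j})=k!\prod_jS(\tau_j)^{\beta_j}\beta_j!$ for distinct $(o_j,\tau_j)$. $L(\tau)=|E_T|+\sum_x|\mathfrak m^X(x)|$ (in $\mathcal V$-notation); $\mathcal W_{\le L}=\{\tau\in\mathcal T^{\mathrm{ex}}:L(\tau)\le L\}$; $\mathbf p_{\le L}$ keeps trees in $\mathcal W_{\le L}$ and kills the others. NONLINEARITIES. $\mathcal Q$ is the set of families $F=(F^{\mathfrak l}_{\mathfrak t})_{\mathfrak t\in\mathfrak L_+,\mathfrak l\in\mathfrak D_{\mathfrak t}}$ in $\mathscr P$ ($F^{\mathfrak l}_{\mathfrak t}=0$ for $\mathfrak l\in\mathfrak D\setminus\mathfrak D_{\mathfrak t}$) such that for all $\mathfrak t$, $(\hat{\mathfrak l},\mathfrak o)\in\mathfrak D$ and $N\in\hat{\mathcal N}(F^{(\hat{\mathfrak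 l},\mathfrak o)}_{\mathfrak t})$, $\mathfrak o\in D(\mathfrak t,N\sqcup\hat{\mathfrak l})$, where $\hat{\mathcal N}(\sum_jG_j\mathcal X^{\alpha_j})=\bigcup_j\{\alpha\sqcup\beta:\alpha\le\alpha_j,\beta\text{ a finite multiset in }\mathcal O(G_j)\}$. $\Upsilon^F_{\mathfrak t}[\Xi_{\mathfrak l}\mathbf X^k\prod_j\mathcal I_{(\mathfrak t_j,p_j)}[\tau_j]]=\prod_j\Upsilon^F_{\mathfrak t_j}[\tau_j]\cdot(\partial^k\prod_jD_{(\mathfrak t_j,p_j)})F^{\mathfrak l}_{\mathfrak t}$. JETS. $\mathbf H^{\mathrm{ex}}=\bigoplus_{\mathfrak t\in\mathfrak L_+}\big(\mathrm{span}\{\mathbf X^p\}\oplus\mathrm{span}\{\mathcal I_{(\mathfrak t,0)}[\tau]\in\mathcal T^{\mathrm{ex}}\}\big)$. $U^R_{\mathfrak t}=\sum_{\tau:\mathcal I_{(\mathfrak t,0)}[\tau]\in\mathcal T^{\mathrm{ex}}}\frac{\langle U_{\mathfrak t},\mathcal I_{(\mathfrak t,0)}[\tau]\rangle}{\langle\tau,\tau\rangle}\tau$, $u^U_{(\mathfrak t,p)}=\langle\mathbf X^p,U_{\mathfrak t}\rangle$, $\mathbf u^U=(u^U_o)_o$. $U_{(\mathfrak t,p)}=\mathscr D^pU_{\mathfrak t}$ with $\mathscr D^p\mathcal I_{(\mathfrak t,0)}[\tau]=\mathcal I_{(\mathfrak t,p)}[\tau]$, $\mathscr D^p\mathbf X^q=\frac{q!}{(q-p)!}\mathbf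 X^{q-p}$ ($0$ unless $q\ge p$). $F^{\mathfrak l}_{\mathfrak t}(U)=\sum_{\alpha\in\mathbb N^{\mathcal O}}\frac{D^\alpha F^{\mathfrak l}_{\mathfrak t}(\mathbf u^U)}{\alpha!}\prod_o(U_o-u^U_o\mathbf 1)^{\alpha_o}$ (formal series, product = joining trees at the root; finitely many terms survive $\mathbf p_{\le L}$). $U$ is coherent to order $L$ with $F$ if $\langle U_{\mathfrak t},\mathcal I_{(\mathfrak t,0)}[\tau]\rangle=\Upsilon^F_{\mathfrak t}[\tau](\mathbf u^U)$ for every $\mathfrak t\in\mathfrak L_+$ and every $\tau$ with $\mathcal I_{(\mathfrak t,0)}[\tau]\in\mathcal W_{\le L+1}$.
   Formalization: The formal theorem additionally assumes that, for each t in L_+ with some F^l_t nonzero, the one-element multiset {(t,0)} belongs to R(t') for some t'; without this no I_(t,0)[τ] lies in T^ex and the equivalence fails. *)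

(* Defs.v *)
From HB Require Import structures.
From mathcomp Require Import all_boot all_order all_algebra finmap multiset.
From mathcomp Require Import all_classical all_reals all_analysis.

Set Implicit Arguments.
Unset Strict Implicit.
Unset Printing Implicit Defensive.

Import Order.TTheory GRing.Theory Num.Theory.
Import numFieldNormedType.Exports.

Local Open Scope classical_set_scope.
Local Open Scope mset_scope.
Local Open Scope ring_scope.

(* Finite rooted trees with decorated nodes (in N) and edges (in E).  A [ptree]
   lists the branches at each node in some order; [tree] below is the type of
   trees up to isomorphism. *)
Inductive ptree (N E : Type) := PNode of N & seq (E * ptree N E).

Section PlanarTrees.
Variables (N E : Type).
Implicit Types t : ptree N E.

Lemma ptree_ind_seq (P : ptree N E -> Prop) :
  (forall a s, foldr (fun x C => P x.2 /\ C) True s -> P (PNode a s)) ->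
  forall t, P t.
Proof.
move=> IH; fix rec 1 => -[a s]; apply: IH.
by elim: s => //= x s IHs; split.
Qed.

Definition rdec t := let: PNode a _ := t in a.
Definition kids t := let: PNode _ s := t in s.

(* The pairs (e, subtree above e), e ranging over the edges: they enumerate the
   edges, and also the nodes x other than the root, e being the edge entering x
   and the subtree above e having x as its root. *)
Fixpoint branches t : seq (E * ptree N E) :=
  let: PNode _ s := t in flatten [seq x :: branches x.2 | x <- s].

Definition edges t : seq E := unzip1 (branches t).

(* A node is represented by the subtree of which it is the root. *)
Definition nodes t : seq (ptree N E) := t :: unzip2 (branches t).

Fixpoint ptree_code t : GenTree.tree (N + E) :=
  let: PNode a s := t in
  GenTree.Node 0 (GenTree.Leaf (inl a) ::
    [seq GenTree.Node 1 [:: GenTree.Leaf (inr x.1); ptree_code x.2] | x <- s]).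

Fixpoint ptree_decode (c : GenTree.tree (N + E)) : option (ptree N E) :=
  if c is GenTree.Node 0 (GenTree.Leaf (inl a) :: cs) then
    Some (PNode a (pmap (fun c' =>
      if c' is GenTree.Node 1 [:: GenTree.Leaf (inr e); c'']
      then omap (pair e) (ptree_decode c'') else None) cs))
  else None.

Lemma ptree_codeK : pcancel ptree_code ptree_decode.
Proof.
elim/ptree_ind_seq => a s IH /=; congr (Some (PNode a _)).
by elim: s IH => //= -[e t] s IHs [/= -> /IHs ->].
Qed.

End PlanarTrees.

HB.instance Definition _ (N E : choiceType) :=
  Choice.copy (ptree N E) (pcan_type (@ptree_codeK N E)).

Section Trees.
Variables (N E : choiceType).
Implicit Types t : ptree N E.

Definition out t : {mset E} := seq_mset (unzip1 (kids t)).

(* Normal form of a planar tree: recursively, the branches at each node are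
   replaced by the canonical enumeration of the multiset they form, so that
   two planar trees have the same normal form iff they are isomorphic. *)
Fixpoint canon t : ptree N E :=
  let: PNode a s := t in
  PNode a (enum_mset (seq_mset [seq (x.1, canon x.2) | x <- s])).

Lemma canon_idem t : canon (canon t) = canon t.
Proof.
elim/ptree_ind_seq: t => a s IH /=; congr (PNode a (enum_mset _)).
set s' := [seq (x.1, canon x.2) | x <- s].
have s'E : [seq (x.1, canon x.2) | x <- s'] = s'.
  rewrite /s' -map_comp; by elim: s IH {s'} => //= x s IHs [-> /IHs ->].
apply/eq_seq_msetP; rewrite -[X in perm_eq _ X]s'E.
exact/perm_map/perm_eq_seq_mset.
Qed.

Definition tree := {t : ptree N E | canon t == t}.

Lemma canonP t : canon (canon t) == canon t.
Proof. exact/eqP/canon_idem. Qed.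

Definition mktree t : tree := exist _ (canon t) (canonP t).

End Trees.

HB.instance Definition _ (N E : choiceType) := Choice.on (tree N E).

Section Setting.
Variables (R : realType) (d : nat) (Lm Lp : finType).

Definition midx := {ffun 'I_d.+1 -> nat}.
HB.instance Definition _ := GRing.Nmodule.on midx.

Definition munit (i : 'I_d.+1) : midx := [ffun j => (j == i : nat)].
Definition mabs (k : midx) : nat := (\sum_i k i)%N.
Definition mfact (k : midx) : nat := (\prod_i (k i)`!)%N.
Definition mle (p q : midx) : bool := [forall i, (p i <= q i)%N].
Definition msub (q p : midx) : midx := [ffun i => (q i - p i)%N].

Definition label : Type := (Lm + Lp)%type.
HB.instance Definition _ := Finite.on label.
Definition etype : Type := (label * midx)%type.
HB.instance Definition _ := Choice.on etype.
Definition otype : Type := (Lp * midx)%type.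
HB.instance Definition _ := Choice.on otype.

Definition etype_of_o (o : otype) : etype := (inr o.1, o.2).
Definition etype_of_noise (e : Lm * midx) : etype := (inl e.1, e.2).

Definition ext : Type := ({ffun 'I_d.+1 -> int} * {ffun label -> int})%type.
HB.instance Definition _ := GRing.Zmodule.on ext.

Definition ext_of_midx (k : midx) : ext := ([ffun i => (k i)%:Z], 0).
Definition ext_of_label (l : label) : ext := (0, [ffun l' => (l' == l)%:Z]).

Variables (s : 'I_d.+1 -> R) (hom : label -> R).
(* [reg None] is the value of reg at the extra symbol 0. *)
Variable reg : option label -> R.
Variable rule : label -> set {mset etype}.

Definition sabs (k : midx) : R := \sum_i (k i)%:R * s i.
Definition rege (e : etype) : R := reg (Some e.1) - sabs e.2.
Definition Oplus : set otype := [set o | 0 < rege (etype_of_o o)].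
Definition Ominus : set otype := [set o | rege (etype_of_o o) < 0].

Definition is_rule : Prop :=
  (forall l, rule l !=set0) /\ (forall l : Lm, rule (inl l) = [set mset0]).

Definition normal_rule : Prop :=
  forall t (M N : {mset etype}), M `<=` N -> rule t N -> rule t M.

Definition subcritical_rule : Prop := forall t : label,
  ((reg (Some t))%:E <
   (hom t)%:E + ereal_inf [set (\sum_(e <- (N : {mset etype})) rege e)%:E
                          | N in rule t])%E.

Definition strongly_conforms (A : choiceType) (T : ptree A etype) : Prop :=
  (exists t, rule t (out T)) /\
  (forall x, x \in branches T -> rule x.1.1 (out x.2)).

Definition add_derivs (N0 : {mset etype}) (m : midx) (N : {mset etype}) : Prop :=
  exists r : seq (etype * midx),
    [/\ N0 = seq_mset (unzip1 r),
        N = seq_mset [seq ((x.1.1, x.1.2 + x.2) : etype) | x <- r] &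
        m = \sum_(x <- r) x.2].

(* A node x of S carries the pair (M(x), n_S(x)); n_S is not part of the
   contraction datum. *)
Definition contraction_datum (t : label) (N : {mset etype})
    (S : ptree ({mset etype} * midx) etype) (m : midx) : Prop :=
  [/\ strongly_conforms S,
      rule t (out S `+` (rdec S).1),
      forall x, x \in branches S -> rule x.1.1 (out x.2 `+` (rdec x.2).1) &
      add_derivs (\big[msetD/mset0]_(x <- nodes S) (rdec x).1) m N].

Definition degm (S : ptree ({mset etype} * midx) etype) : R :=
  \sum_(e <- edges S) (hom e.1 - sabs e.2) +
  \sum_(x <- nodes S) sabs (rdec x).2.

Definition complete_rule : Prop := forall t N S m,
  contraction_datum t N S m -> (forall x, x \in nodes S -> (rdec x).2 = 0) ->
  degm S + sabs m < 0 -> rule t N.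

Definition Dext (t : label) (N : {mset etype}) : set ext :=
  [set o | rule t N /\
    (o = 0 \/ exists S m,
      [/\ contraction_datum t N S m, degm S + sabs m < 0 &
          o = \sum_(e <- edges S) (ext_of_label e.1 - ext_of_midx e.2) +
              \sum_(x <- nodes S) ext_of_midx (rdec x).2 - ext_of_midx m])].

(* All pairs are allowed as node decorations of trees, not only those in [Dall]:
   a tree outside [Tex] is killed by [ptrunc], and nonlinearities in [Qnonlin]
   vanish at the drivers outside [Dt]. *)
Definition driver : Type := ({mset (Lm * midx)} * ext)%type.
HB.instance Definition _ := Choice.on driver.

Definition driver0 : driver := (mset0, 0).
Definition driverD (l l' : driver) : driver := (l.1 `+` l'.1, l.2 + l'.2).

Definition noise (N : {mset (Lm * midx)}) : {mset etype} :=
  seq_mset [seq etype_of_noise e | e <- N].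

Definition Dhat : set {mset (Lm * midx)} :=
  [set N | exists t : Lp, rule (inr t) (noise N)].
Definition Dt (t : Lp) : set driver :=
  [set l | Dhat l.1 /\ Dext (inr t) (noise l.1) l.2].
Definition Dall : set driver := [set l | exists t, Dt t l].

Definition vtree := tree (driver * midx)%type otype.
HB.instance Definition _ := Choice.on vtree.

(* The trees T^{n,o}_e with all their edges; a node x carries (n(x), o(x)). *)
Definition full_tree := ptree (midx * ext) etype.

Definition Tex_full (T : full_tree) : Prop :=
  [/\ strongly_conforms T,
      forall x, x \in branches T -> is_inl x.1.1 -> (rdec x.2).1 = 0,
      forall x, x \in branches T -> Dext x.1.1 (out x.2) (rdec x.2).2 &
      exists t, Dext t (out T) (rdec T).2].

Fixpoint prune (T : full_tree) : ptree (driver * midx) otype :=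
  let: PNode (n, o) r := T in
  PNode ((seq_mset (pmap (fun x : etype * full_tree =>
            if x.1 is (inl l, p) then Some (l, p) else None) r), o), n)
        (pmap (fun x : etype * full_tree =>
            if x.1 is (inr t, p) then Some ((t, p), prune x.2) else None) r).

Definition Tex : set vtree :=
  [set tau | exists T, Tex_full T /\ tau = mktree (prune T)].

Definition vnode (l : driver) (k : midx) (r : seq (otype * vtree)) : vtree :=
  mktree (PNode (l, k) [seq (x.1, \val x.2) | x <- r]).

Definition Xi (l : driver) : vtree := vnode l 0 [::].
Definition Xpow (k : midx) : vtree := vnode driver0 k [::].
Definition tone : vtree := vnode driver0 0 [::].
Definition planted (o : otype) (tau : vtree) : vtree := vnode driver0 0 [:: (o, tau)].

(* Joining at the root.  The drivers of the two roots are added; it is only used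
   for trees at most one of which has a root driver other than [driver0]. *)
Definition tjoin (tau sigma : vtree) : vtree :=
  mktree (PNode (driverD (rdec (\val tau)).1 (rdec (\val sigma)).1,
                 (rdec (\val tau)).2 + (rdec (\val sigma)).2)
                (kids (\val tau) ++ kids (\val sigma))).

(* The product of S(tau_j) ^ beta_j over distinct branches is the product of
   S over all branches.  Equality of planar branches is isomorphism only for
   trees in normal form. *)
Fixpoint psym (t : ptree (driver * midx) otype) : nat :=
  let: PNode (_, k) r := t in
  (mfact k * foldr (fun x c => psym x.2 * c) 1 r *
   \prod_(x <- undup r) (count_mem x r)`!)%N.
Definition tsym (tau : vtree) : nat := psym (\val tau).

Definition Lsize (tau : vtree) : nat :=
  (size (edges (\val tau)) + \sum_(x <- nodes (\val tau)) mabs (rdec x).2)%N.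

Definition Wtrees (L : nat) : set vtree := [set tau | Tex tau /\ (Lsize tau <= L)%N].

(* Elements of spaces spanned by trees, and formal series of trees, are
   functions giving the coefficient of each tree.  The sums over infinite index
   sets below are the finite-support sums of fsbigop; for the functions, jets
   and trees considered they always have finitely many non-zero terms. *)

Definition fseries : Type := vtree -> R.

Definition deltat (tau : vtree) : fseries := fun sigma => (sigma == tau)%:R.

Definition ptrunc (L : nat) (f : fseries) : fseries :=
  fun tau => if `[< Wtrees L tau >] then f tau else 0.

Definition tinner (f g : fseries) : R :=
  \sum_(tau \in [set: vtree]) f tau * g tau * (tsym tau)%:R.

Definition smul (f g : fseries) : fseries := fun tau =>
  \sum_(x \in [set x : vtree * vtree | tjoin x.1 x.2 = tau]) f x.1 * g x.2.

Definition sprod (r : seq fseries) : fseries := foldr smul (deltat tone) r.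

Definition fn : Type := (otype -> R) -> R.

Definition depends_on (A : set otype) (G : fn) : Prop :=
  forall x y, (forall o, A o -> x o = y o) -> G x = G y.

Definition coords (G : fn) : set otype :=
  \bigcap_(A in [set A | depends_on A G]) A.

Definition slice (G : fn) (x : otype -> R) (o : otype) : R -> R :=
  fun r => G (@dfwith otype (fun=> R) x o r).

Definition pderiv (o : otype) (G : fn) : fn := fun x => derive1 (slice G x o) (x o).

(* On smooth functions neither the order in [r] below, nor the order in which
   [dXpow] applies the [dX i], matters. *)
Definition pderivs (r : seq otype) (G : fn) : fn := foldr pderiv G r.

Definition Dmulti (alpha : {mset otype}) (G : fn) : fn := pderivs alpha G.

Definition CO : set fn := [set G |
  (exists A : {fset otype}, depends_on [set` A] G) /\
  forall r : seq otype,
    continuous (pderivs r G : {ptws otype -> R} -> R) /\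
    forall o x, derivable (slice (pderivs r G) x o) (x o) 1].

Definition dX (i : 'I_d.+1) (G : fn) : fn := fun x =>
  \sum_(o \in [set: otype]) x (o.1, o.2 + munit i) * pderiv o G x.

Definition dXpow (k : midx) (G : fn) : fn :=
  foldr (fun i H => iter (k i) (dX i) H) G (enum 'I_d.+1).

Definition monomial (alpha : {mset otype}) : fn :=
  fun x => \prod_(o <- alpha) x o.

(* [r] lists the pairs (alpha_j, G_j) of the representation of G. *)
Definition poly_rep (G : fn) (r : seq ({mset otype} * fn)) : Prop :=
  [/\ uniq (unzip1 r),
      forall x : {mset otype} * fn, x \in r ->
        [/\ forall o, o \in x.1 -> Ominus o, CO x.2,
            depends_on Oplus x.2 & x.2 <> (fun=> 0)] &
      G = fun u => \sum_(x <- r) x.2 u * monomial x.1 u].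

Definition polyfn : set fn := [set G | CO G /\ exists r, poly_rep G r].

Definition Nhat (G : fn) : set {mset otype} := [set N |
  exists r (x : {mset otype} * fn) (alpha beta : {mset otype}),
    [/\ poly_rep G r, x \in r, alpha `<=` x.1,
        forall o, o \in beta -> coords x.2 o & N = alpha `+` beta]].

Definition nonlin : Type := Lp -> driver -> fn.

Definition Qnonlin : set nonlin := [set F |
  [/\ forall t l, polyfn (F t l),
      forall t l, ~ Dt t l -> F t l = fun=> 0 &
      forall t l N, Dall l -> Nhat (F t l) N ->
        Dext (inr t) (seq_mset [seq etype_of_o o | o <- N] `+` noise l.1) l.2]].

Fixpoint upsilon_rec (F : nonlin) (tau : ptree (driver * midx) otype) (t : Lp)
    : fn :=
  let: PNode (l, k) r := tau in
  fun u => foldr (fun x c => upsilon_rec F x.2 x.1.1 u * c) 1 r *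
           dXpow k (pderivs (unzip1 r) (F t l)) u.

Definition upsilon (F : nonlin) (t : Lp) (tau : vtree) : fn :=
  upsilon_rec F (\val tau) t.

Definition jet : Type := Lp -> fseries.

Definition Hex : set jet := [set U | forall t,
  finite_set [set tau | U t tau != 0] /\
  forall tau, U t tau != 0 ->
    (exists p, tau = Xpow p) \/
    (exists sigma, tau = planted (t, 0) sigma /\ Tex tau)].

Definition jetR (U : jet) (t : Lp) : fseries := fun sigma =>
  \sum_(tau \in [set tau | Tex (planted (t, 0) tau)])
    tinner (U t) (deltat (planted (t, 0) tau)) / tinner (deltat tau) (deltat tau) *
    deltat tau sigma.

Definition jetu (U : jet) : otype -> R :=
  fun o => tinner (deltat (Xpow o.2)) (U o.1).

(* U_(t,p): linear extension of the action of the p-th derivative on the X^q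
   and on the planted trees, which span the space containing U_t. *)
Definition jetD (U : jet) (o : otype) : fseries := fun sigma =>
  \sum_(q \in [set q : midx | mle o.2 q])
    U o.1 (Xpow q) * ((mfact q)%:R / (mfact (msub q o.2))%:R) *
    deltat (Xpow (msub q o.2)) sigma +
  \sum_(tau \in [set: vtree])
    U o.1 (planted (o.1, 0) tau) * deltat (planted o tau) sigma.

Definition multifact (alpha : {mset otype}) : nat :=
  (\prod_(o <- finsupp alpha) (alpha o)`!)%N.

Definition nonlin_at (F : nonlin) (U : jet) (t : Lp) (l : driver) : fseries :=
  fun sigma => \sum_(alpha \in [set: {mset otype}])
    Dmulti alpha (F t l) (jetu U) / (multifact alpha)%:R *
    sprod [seq (fun tau => jetD U o tau - jetu U o * deltat tone tau)
          | o <- (alpha : {mset otype})] sigma.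

Definition coherent (F : nonlin) (L : nat) (U : jet) : Prop :=
  forall t tau, Wtrees L.+1 (planted (t, 0) tau) ->
    tinner (U t) (deltat (planted (t, 0) tau)) = upsilon F t tau (jetu U).

(* The edge (t, 0) may leave the root of a strongly conforming tree as soon as
   F_t is not zero.  Otherwise no planted tree I_(t,0)[tau] is in [Tex], so that
   a jet has U^R_t = 0 and its coherence says nothing about the type t, while
   the coefficients F^l_t(u^U) of the trees [Xi l] need not vanish. *)
Definition plantable (F : nonlin) : Prop := forall t : Lp,
  (exists l, F t l <> fun=> 0) ->
  exists t', rule t' [mset ((inr t, 0) : etype)].

End Setting.

(* Main.v *)
(* For a tree sigma = Xi_l X^k prod_j I_(t_j,p_j)[tau_j], the coefficient of sigma
   in F^l_t(U) Xi_l, multiplied by the symmetry factor S(sigma), equals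
     (d^k prod_j D_(t_j,p_j) F^l_t)(u^U)
       * prod_j S(tau_j) <coefficient of I_(t_j,0)[tau_j] in U_(t_j)>.
   This is a Faa di Bruno formula.  Encode the coefficients of a series, weighted
   by symmetry factors, as a function on words whose letters are the X_i and the
   planted branches.  The product of trees then becomes the shuffle product, for
   which removing the first letter is a derivation.  Removing a branch
   I_o[tau] from the Taylor series of G along U gives the coefficient of tau
   times the Taylor series of D_o G; removing X_i gives the Taylor series of
   d_i G.  Given the formula, both directions of the theorem follow by
   induction on the branches tau_j.  The branches of a conforming tree are
   conforming at their own edge types, but I_(t,0)[tau] may still fail to be
   allowed; then F_t = 0 and both sides vanish.  Conversely, if a tree conforms
   to the rule but not at the root type t, then d^k prod_j D_(t_j,p_j) F^l_t = 0
   by the condition on N^(F^l_t). *)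

Require Import Defs.
From mathcomp Require Import all_boot all_order all_algebra finmap multiset.
From mathcomp Require Import all_classical all_reals all_analysis.
From mathcomp Require Import ring.
Import Order.TTheory GRing.Theory Num.Theory.
Import numFieldNormedType.Exports.
Local Open Scope classical_set_scope.
Local Open Scope mset_scope.
Local Open Scope ring_scope.

Set Implicit Arguments.
Unset Strict Implicit.
Unset Printing Implicit Defensive.

(** * Partial derivatives commute *)

(** The order in which letters are removed is forced. Removing a branch from the increment of U_o
    leaves a multiple of the unit, whatever the rest of the word. Removing X_i turns the increment
    of U_o into U_(o+e_i) only on words of X letters: on the word made of X_i and I_(o+e_i)[tau],
    U_o vanishes, whereas U_(o+e_i) may be non-zero at I_(o+e_i)[tau]. So all branches are removed
    before the polynomial part. The sum over multi-indices alpha is awkward for induction. It is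
    regrouped by degree, the term of degree n being an n-fold iteration of: sum over o of the
    increment of o times the series of D_o G. Increments have no constant term, so a word of length
    less than N only sees degrees below N, and one degree of truncation is spent per letter. Each
    d_i enlarges the set of coordinates involved, so the sums run over a finite set fixed in advance
    and large enough for all letters. Reordering derivatives requires Schwarz's theorem for [CO],
    which is obtained from the mean value theorem. *)

Lemma continuous_ptws (T : topologicalType) (I : Type) (K : topologicalType)
    (f : T -> {ptws I -> K}) :
  (forall i, continuous (fun t => f t i)) -> continuous f.
Proof.
move=> fc x; apply/cvg_sup.
move=> i; move: x; apply/(@continuousP _ (initial_topology (@^~ i))) => A [B ? E].
rewrite -E; have -> : f @^-1` (@^~ i @^-1` B) = (fun t => f t i) @^-1` B by [].
by move/continuousP : (fc i); apply.
Qed.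

Section Smooth.
Variables (R : realType) (d : nat) (Lp : finType).
Local Notation otype := (otype d Lp).
Local Notation fn := (fn R d Lp).
Implicit Types (G H : fn) (o : otype) (x : otype -> R) (A : set otype).

Local Notation upd x o r := (@dfwith otype (fun=> R) x o r).

Lemma upd_id x o : upd x o (x o) = x.
Proof. by apply/funext => i; case: dfwithP. Qed.

Lemma upd_upd x o a b : upd (upd x o a) o b = upd x o b.
Proof.
apply/funext => i; case: dfwithP => [|j oj]; first by rewrite dfwithin.
by rewrite !dfwithout.
Qed.

Lemma upd_comm x o o' a b : o != o' ->
  upd (upd x o a) o' b = upd (upd x o' b) o a.
Proof.
move=> oo'; apply/funext => i; case: (eqVneq o' i) => [<-|o'i].
  by rewrite dfwithin dfwithout// dfwithin.
rewrite dfwithout//; case: (eqVneq o i) => [<-|oi].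
  by rewrite !dfwithin.
by rewrite !dfwithout.
Qed.

Lemma updE x o r o' : upd x o r o' = if o' == o then r else x o'.
Proof. by case: dfwithP => [|j]; rewrite ?eqxx// eq_sym => /negPf ->. Qed.

Lemma slice_upd G x o r : slice G (upd x o r) o = slice G x o.
Proof. by apply/funext => t; rewrite /slice upd_upd. Qed.

Lemma pderiv_upd o G x r :
  pderiv o G (upd x o r) = derive1 (slice G x o) r.
Proof. by rewrite /pderiv slice_upd dfwithin. Qed.

Lemma depends_pderiv A o G : depends_on A G -> depends_on A (pderiv o G).
Proof.
move=> GA x y xy; rewrite /pderiv.
have [oA|oA] := pselect (A o).
  by rewrite (xy o oA); congr (derive1 _ _); apply/funext => r;
     apply: GA => o' o'A; rewrite !updE; case: ifP => // _; exact: xy.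
have E z : slice G z o = fun=> G z.
  apply/funext => r; apply: GA => o' o'A; rewrite updE; case: eqP => // o'E.
  by rewrite o'E in o'A.
by rewrite !E (derive1_cst (G x) (x o)) (derive1_cst (G y) (y o)).
Qed.

Lemma CO_pderiv o G : CO G -> CO (pderiv o G).
Proof.
case=> [[A GA] Gr]; split; first by exists A; exact: depends_pderiv.
by move=> r; have := Gr (rcons r o); rewrite /pderivs -cats1 foldr_cat.
Qed.

Lemma pderiv_notin A o G : depends_on A G -> ~ A o -> pderiv o G = fun=> 0.
Proof.
move=> GA oA; apply/funext => x; rewrite /pderiv.
have -> : slice G x o = fun=> G x.
  apply/funext => r; apply: GA => o' o'A; rewrite updE; case: eqP => // o'E.
  by rewrite o'E in o'A.
exact: derive1_cst.
Qed.

(** [CO] asks for derivability only at the base coordinate [x o]. A slice does not see the value of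
    [x] at [o], so moving the base point gives every [r]. *)
Lemma CO_derivable G x o r : CO G -> derivable (slice G x o) r 1.
Proof.
case=> _ /(_ [::])[_ /(_ o (upd x o r))].
by rewrite /= dfwithin slice_upd.
Qed.

Lemma slice_MVT G x o (a b : R) : CO G -> a < b ->
  exists2 c, c \in `]a, b[ &
    G (upd x o b) - G (upd x o a) = pderiv o G (upd x o c) * (b - a).
Proof.
move=> cG ab.
have [||c cab E] := @MVT R (slice G x o) (derive1 (slice G x o)) a b ab.
  move=> t _; rewrite derive1E; apply: derivableP; exact: CO_derivable.
  apply: derivable_within_continuous => t _; exact: CO_derivable.
by exists c => //; rewrite pderiv_upd.
Qed.

(** The second difference over a rectangle is an increment of the difference of two parallel slices:
    the mean value theorem applies to it in direction [o], and then to [pderiv o G] in direction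
    [o']. *)
Lemma rectangle_MVT G x o o' (a0 a1 b0 b1 : R) : CO G -> o != o' ->
  a0 < a1 -> b0 < b1 ->
  exists a b, [/\ a \in `]a0, a1[, b \in `]b0, b1[ &
    G (upd (upd x o a1) o' b1) - G (upd (upd x o a1) o' b0) -
    (G (upd (upd x o a0) o' b1) - G (upd (upd x o a0) o' b0)) =
    pderiv o' (pderiv o G) (upd (upd x o a) o' b) * (b1 - b0) * (a1 - a0)].
Proof.
move=> cG oo' a01 b01.
pose f := slice G (upd x o' b1) o - slice G (upd x o' b0) o.
have fd t : derivable f t 1.
  by apply: derivableB; exact: CO_derivable.
have [||a aI E] := @MVT R f (derive1 f) a0 a1 a01.
  move=> t _; rewrite derive1E; apply: derivableP; exact: fd.
  apply: derivable_within_continuous => t _; exact: fd.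
have [b bI E'] := slice_MVT (upd x o a) o' (CO_pderiv o cG) b01.
exists a, b; split => //.
rewrite -E'; move: E; rewrite derive1E /f deriveB; try exact: CO_derivable.
rewrite -!derive1E -!pderiv_upd !(@upd_comm x o') 1?eq_sym// => <-.
by rewrite !fctE /slice !(@upd_comm x o') 1?eq_sym.
Qed.

Lemma CO_continuous_upd2 G x o o' (e : R) : CO G -> 0 < e ->
  exists2 D : R, 0 < D & forall a b, `|a - x o| < D -> `|b - x o'| < D ->
    `|G (upd (upd x o a) o' b) - G x| < e.
Proof.
case=> _ /(_ [::])[/= cG _] e0.
pose f (p : R * R) : {ptws otype -> R} := upd (upd x o p.1) o' p.2.
have cf : continuous f.
  apply: continuous_ptws => i; rewrite /f.
  have -> : (fun t => upd (upd x o t.1) o' t.2 i) = fun t : R * R =>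
     if i == o' then t.2 else if i == o then t.1 else x i.
    by apply/funext => t; rewrite !updE.
  case: eqP => _; first by move=> p; exact: cvg_snd.
  case: eqP => _; first by move=> p; exact: cvg_fst.
  by move=> p; exact: cvg_cst.
have fx : f (x o, x o') = x.
  by rewrite /f /= upd_id upd_id.
have cGf : (G \o f) @ (x o, x o') --> (G \o f) (x o, x o').
  exact: (@continuous_comp _ {ptws otype -> R} _ f G (x o, x o') (cf _) (cG _)).
have GfE : (G \o f) (x o, x o') = G x by rewrite -[in RHS]fx.
move: cGf; rewrite GfE => /cvgrPdist_lt/(_ e e0).
case=> -[P Q] /= [/nbhs_ballP[d1 d10 P1] /nbhs_ballP[d2 d20 Q2]] PQ.
exists (Num.min d1 d2); first by rewrite lt_min d10 d20.
move=> a b; rewrite !lt_min => /andP[ad1 _] /andP[_ bd2].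
rewrite distrC; apply: (PQ (a, b)); split => /=.
  by apply: P1; rewrite /ball /= distrC.
by apply: Q2; rewrite /ball /= distrC.
Qed.

Lemma eq_approx (u v : R) :
  (forall e, 0 < e -> exists w, `|w - u| < e /\ `|w - v| < e) -> u = v.
Proof.
move=> H; apply/eqP/negPn/negP => uv.
have [|w [wu wv]] := H (`|u - v| / 2).
  by rewrite divr_gt0// normr_gt0 subr_eq0.
have : `|u - v| < `|u - v| / 2 + `|u - v| / 2.
  rewrite {1}(_ : u - v = (w - v) - (w - u)); last by ring.
  by rewrite (le_lt_trans (ler_normB _ _))// ltrD.
by rewrite -splitr ltxx.
Qed.

(** Schwarz's theorem. Both mixed derivatives at [x] are compared, through [eq_approx], with one
    value that each of them takes close to [x]. *)
Lemma pderivC G o o' : CO G -> pderiv o (pderiv o' G) = pderiv o' (pderiv o G).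
Proof.
move=> cG; have [->//|oo'] := eqVneq o o'.
apply/funext => x; apply: eq_approx => e e0.
have [D1 D10 H1] := CO_continuous_upd2 x o' o (CO_pderiv o (CO_pderiv o' cG)) e0.
have [D2 D20 H2] := CO_continuous_upd2 x o o' (CO_pderiv o' (CO_pderiv o cG)) e0.
have [D [D0 DD1 DD2]] : exists D, [/\ 0 < D, D < D1 & D < D2].
  have h (y : R) : 0 < y -> y / 2 < y by move=> *; rewrite ltr_pdivrMr// ltr_pMr// ltr1n.
  have m0 : 0 < Num.min D1 D2 by rewrite lt_min D10.
  exists (Num.min D1 D2 / 2); split; first by rewrite divr_gt0.
    by rewrite (lt_le_trans (h _ m0))// ge_min lexx.
  by rewrite (lt_le_trans (h _ m0))// ge_min lexx orbT.
have o'o : o' != o by rewrite eq_sym.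
have xo y : y < y + D by rewrite ltrDl.
have [a [b [aI bI E]]] := rectangle_MVT x cG oo' (xo (x o)) (xo (x o')).
have [b' [a' [bI' aI' E']]] := rectangle_MVT x cG o'o (xo (x o')) (xo (x o)).
have near y c (D' : R) : D < D' -> c \in `]y, y + D[ -> `|c - y| < D'.
  move=> DD'; rewrite in_itv/= => /andP[yc cy]; rewrite gtr0_norm ?subr_gt0//.
  by rewrite ltrBlDl (lt_trans cy)// ltrD2l.
have {}H1 := H1 _ _ (near _ _ _ DD1 bI') (near _ _ _ DD1 aI').
have {}H2 := H2 _ _ (near _ _ _ DD2 aI) (near _ _ _ DD2 bI).
(* Both mean value formulas compute the same second difference over a square of side [D]; dividing
   by [D * D] identifies the two mixed derivatives at their intermediate points. *)
have EE : pderiv o' (pderiv o G) (upd (upd x o a) o' b) =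
          pderiv o (pderiv o' G) (upd (upd x o' b') o a').
  have DN : D * D != 0 by rewrite mulf_neq0 ?gt_eqF.
  apply: (mulIf DN).
  transitivity (pderiv o' (pderiv o G) (upd (upd x o a) o' b) *
     (x o' + D - x o') * (x o + D - x o)); first by ring.
  rewrite -E; transitivity (pderiv o (pderiv o' G) (upd (upd x o' b') o a') *
     (x o + D - x o) * (x o' + D - x o')); last by ring.
  rewrite -E' !(@upd_comm x o') //; ring.
rewrite EE in H2.
exists (pderiv o (pderiv o' G) (upd (upd x o' b') o a')); split.
  exact: H1.
exact: H2.
Qed.

End Smooth.

(** * Closure properties of smooth functions *)

Section SmoothAlgebra.
Variables (R : realType) (d : nat) (Lp : finType).
Local Notation otype := (otype d Lp).
Local Notation fn := (fn R d Lp).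
Implicit Types (G H : fn) (o : otype) (x : otype -> R) (A : set otype).
Local Notation upd x o r := (@dfwith otype (fun=> R) x o r).

Lemma CO_pderivs r G : CO G -> CO (pderivs r G).
Proof. by move=> cG; elim: r => [|o r IH]; [exact: cG|exact: CO_pderiv]. Qed.

Lemma pderiv_add o G H : CO G -> CO H ->
  pderiv o (fun x => G x + H x) = fun x => pderiv o G x + pderiv o H x.
Proof.
move=> cG cH; apply/funext => x; rewrite /pderiv !derive1E.
by rewrite -deriveD//; exact: CO_derivable.
Qed.

Lemma pderivs_add r G H : CO G -> CO H ->
  pderivs r (fun x => G x + H x) = fun x => pderivs r G x + pderivs r H x.
Proof.
move=> cG cH; elim: r => [|o r IH]; first by [].
by rewrite /= IH pderiv_add; [|exact: CO_pderivs..].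
Qed.

Lemma pderiv_scale o (c : R) G : CO G ->
  pderiv o (fun x => c * G x) = fun x => c * pderiv o G x.
Proof.
move=> cG; apply/funext => x; rewrite /pderiv !derive1E.
by rewrite -deriveMl//; exact: CO_derivable.
Qed.

Lemma pderivs_scale r (c : R) G : CO G ->
  pderivs r (fun x => c * G x) = fun x => c * pderivs r G x.
Proof.
move=> cG; elim: r => [|o r IH]; first by [].
by rewrite /= IH pderiv_scale; [|exact: CO_pderivs].
Qed.

Lemma pderivs_0 r : pderivs r (fun=> 0 : R) = (fun=> 0) :> fn.
Proof.
elim: r => [|o r IH]; first by [].
rewrite /= IH; apply/funext => x.
exact: (derive1_cst (0 : R) (x o)).
Qed.

Lemma CO_add G H : CO G -> CO H -> CO (fun x => G x + H x).
Proof.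
move=> cG cH; split.
  case: cG cH => [[A GA] _] [[B HB] _]; exists (A `|` B)%fset => x y xy.
  by rewrite (GA x y) ?(HB x y)// => o /= oA; apply: xy => /=;
     rewrite inE oA ?orbT.
move=> r; rewrite pderivs_add; [|exact: cG|exact: cH].
case: cG cH => _ /(_ r)[Gc Gd] [_ /(_ r)[Hc Hd]].
split=> [x|o x]; first exact: (cvgD (Gc x) (Hc x)).
exact: (derivableD (Gd o x) (Hd o x)).
Qed.

Lemma CO_scale (c : R) G : CO G -> CO (fun x => c * G x).
Proof.
move=> cG; split.
  by case: cG => [[A GA] _]; exists A => x y xy; rewrite (GA x y).
move=> r; rewrite pderivs_scale; [|exact: cG]; case: cG => _ /(_ r)[Gc Gd].
split=> [x|o x]; first exact: (cvgM (cvg_cst c) (Gc x)).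
exact: (derivableM (derivable_cst c _ _) (Gd o x)).
Qed.

Lemma CO_0 : @CO R d Lp (fun=> 0).
Proof.
split; first by exists fset0.
move=> r; rewrite pderivs_0; split=> [|o x].
  exact: (@cst_continuous {ptws otype -> R} R 0).
exact: (derivable_cst (0 : R)).
Qed.

Lemma CO_sum_seq (I : eqType) (r : seq I) (G : I -> fn) :
  (forall i, i \in r -> CO (G i)) -> CO (fun x => \sum_(i <- r) G i x).
Proof.
elim: r => [|i r IH] cG.
  have -> : (fun x => \sum_(i <- [::]) G i x) = fun=> 0.
    by apply/funext => x; rewrite big_nil.
  exact: CO_0.
under eq_fun do rewrite big_cons; apply: CO_add; first by apply: cG; rewrite mem_head.
by apply: IH => j jr; apply: cG; rewrite inE jr orbT.
Qed.

Lemma pderivs_sum_seq (I : eqType) (r : seq I) (G : I -> fn) w :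
  (forall i, i \in r -> CO (G i)) ->
  pderivs w (fun x => \sum_(i <- r) G i x) =
  fun x => \sum_(i <- r) pderivs w (G i) x.
Proof.
elim: r => [|i r IH] cG.
  by under eq_fun do rewrite big_nil; rewrite pderivs_0;
     apply/funext => x; rewrite big_nil.
have cr j : j \in r -> CO (G j) by move=> jr; apply: cG; rewrite inE jr orbT.
under eq_fun do rewrite big_cons; rewrite pderivs_add ?IH//.
- by apply/funext => x; rewrite big_cons.
- by apply: cG; rewrite mem_head.
- exact: CO_sum_seq.
Qed.

Lemma pderiv_coordM o o' G : CO G -> pderiv o' (fun x => x o * G x) =
  fun x => x o * pderiv o' G x + (o == o')%:R * G x.
Proof.
move=> cG; apply/funext => x; rewrite /pderiv.
have [<-|oo'] := eqVneq o o'.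
  have -> : slice (fun y => y o * G y) x o = id * slice G x o.
    by apply/funext => r; rewrite /slice fctE dfwithin.
  rewrite !derive1E deriveM//; last exact: CO_derivable.
  rewrite derive_id /slice upd_id mul1r.
  by congr (_ + _); rewrite /GRing.scale /= mulr1.
rewrite [slice (fun _ => _) x o'](_ : _ = fun r => x o * slice G x o' r).
  by rewrite !derive1E deriveMl ?mul0r ?addr0//; exact: CO_derivable.
by apply/funext => r; rewrite /slice dfwithout// eq_sym.
Qed.

Lemma pderiv_sum_seq (I : eqType) (r : seq I) (G : I -> fn) o :
  (forall i, i \in r -> CO (G i)) ->
  pderiv o (fun x => \sum_(i <- r) G i x) =
  fun x => \sum_(i <- r) pderiv o (G i) x.
Proof. exact: (@pderivs_sum_seq I r G [:: o]). Qed.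

Lemma coord_continuous o : continuous ((fun x => x o) : {ptws otype -> R} -> R).
Proof. by move=> x; exact: (@proj_continuous _ (fun=> R) o). Qed.

Lemma coord_derivable o o' x : derivable (fun r => upd x o' r o) (x o') 1.
Proof.
have [->|oo'] := eqVneq o o'.
  rewrite (_ : (fun r => _) = id); last by apply/funext => r; rewrite dfwithin.
  exact: derivable_id.
rewrite (_ : (fun r => _) = fun=> x o); first exact: derivable_cst.
by apply/funext => r; rewrite dfwithout// eq_sym.
Qed.

Lemma CO_coordM o G : CO G -> CO (fun x => x o * G x).
Proof.
move=> cG.
have cr w : CO (pderivs w G) by exact: CO_pderivs.
(* Induction on derivatives needs a closed form: besides [x o * pderivs r G] only terms without the
   factor [x o] appear, and [L] collects their words. *)
have E r : exists L : seq (seq otype), pderivs r (fun x => x o * G x) =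
    fun x => x o * pderivs r G x + \sum_(w <- L) pderivs w G x.
  elim: r => [|o' r [L IH]].
    by exists [::]; apply/funext => x; rewrite big_nil addr0.
  (* A new correction term arises exactly when the derivative hits the factor [x o]; the boolean
     serves as the multiplicity of [r]. *)
  exists (nseq (o == o') r ++ [seq o' :: w | w <- L]).
  have cS : CO (fun x => \sum_(w <- L) pderivs w G x).
    by apply: CO_sum_seq => w _; exact: cr.
  have := pderiv_coordM o o' (cr r).
  have : pderiv o' (fun x => \sum_(w <- L) pderivs w G x) =
      fun x => \sum_(w <- L) pderivs (o' :: w) G x.
    by apply: pderiv_sum_seq => w _; exact: cr.
  rewrite /= IH /pderiv => E1 E2; apply/funext => x.
  rewrite derive1E /slice
    -[fun r => _]/((fun r0 => upd x o' r0 o * slice (pderivs r G) x o' r0) +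
                   slice (fun x => \sum_(w <- L) pderivs w G x) x o').
  rewrite deriveD.
  - rewrite -!derive1E (congr1 (fun f => f x) E1) (congr1 (fun f => f x) E2).
    rewrite big_cat big_map -addrA; congr (_ + (_ + _)).
    by case: eqP => _; rewrite ?big_seq1 ?big_nil ?mul1r ?mul0r.
  - apply: derivableM; first exact: coord_derivable.
    apply: CO_derivable; exact: cr.
  - exact: CO_derivable.
split.
  case: cG => [[A GA] _]; exists (o |` A)%fset => x y xy.
  congr (_ * _); first by apply: xy; rewrite /= !inE eqxx.
  by apply: GA => o' /= o'A; apply: xy; rewrite /= !inE o'A orbT.
move=> r; have [L ->] := E r.
have [_ /(_ [::])[/= cS dS]] : CO (fun x => \sum_(w <- L) pderivs w G x).
  by apply: CO_sum_seq => w _; exact: cr.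
have [_ /(_ [::])[/= cP dP]] := cr r.
split=> [x|o' x].
  exact: (cvgD (cvgM (@coord_continuous o x) (cP x)) (cS x)).
exact: (derivableD (derivableM (@coord_derivable o o' x) (dP o' x)) (dS o' x)).
Qed.

Lemma CO_dX_term o o' G : CO G -> CO (fun x => x o * pderiv o' G x).
Proof. by move=> cG; apply: CO_coordM; exact: CO_pderiv. Qed.

End SmoothAlgebra.

(** * Derivatives of nonlinearities *)

Section Derivatives.
Variables (R : realType) (d : nat) (Lp : finType).
Local Notation otype := (otype d Lp).
Local Notation fn := (fn R d Lp).
Implicit Types (G H : fn) (o : otype) (x : otype -> R) (A : set otype).

Lemma pderivs_perm r r' G : CO G -> perm_eq r r' -> pderivs r G = pderivs r' G.
Proof.
move=> cG; elim: r r' => [|o r IH] r' rr'.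
  by move: rr'; rewrite perm_sym => /perm_nilP ->.
have or' : o \in r' by rewrite -(perm_mem rr') mem_head.
case/splitPr: or' rr' => a b rr'.
have {}rr' : perm_eq r (a ++ b).
  by rewrite -(perm_cons o) (perm_trans rr')// (perm_catCA a [:: o]).
rewrite /= (IH _ rr'); elim: a {IH rr'} => [|o' a IHa]; first by [].
by rewrite /= -IHa pderivC; [|exact: CO_pderivs].
Qed.

Lemma pderivs_pderiv r o G : CO G -> pderivs r (pderiv o G) = pderivs (o :: r) G.
Proof.
move=> cG; rewrite -(pderivs_perm (r := rcons r o) cG) ?perm_rcons//.
by rewrite /pderivs -cats1 foldr_cat.
Qed.

Lemma depends_sub A B G : (A `<=` B)%classic -> depends_on A G -> depends_on B G.
Proof. by move=> AB GA x y xy; apply: GA => o /AB; exact: xy. Qed.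

Lemma dXE (A : {fset otype}) i G : depends_on [set` A] G ->
  dX i G = fun x => \sum_(o <- A) x (o.1, o.2 + munit i) * pderiv o G x.
Proof.
move=> GA; apply/funext => x; rewrite /dX (@fsbigTE _ _ _ _ A)// => o oA.
by rewrite (pderiv_notin GA) ?mulr0//; apply/negP.
Qed.

Lemma CO_dX i G : CO G -> CO (dX i G).
Proof.
move=> cG; have [[A GA] _] := cG; rewrite (dXE i GA).
by apply: CO_sum_seq => o _; exact: CO_dX_term.
Qed.

Lemma dX_0 i : dX i (fun=> 0) = (fun=> 0) :> fn.
Proof.
apply/funext => x; rewrite /dX fsbig1// => o _.
by rewrite (pderiv_notin (A := set0))// ?mulr0// => y z _.
Qed.

Definition dXs (w : seq 'I_d.+1) G : fn := foldr (@dX R d Lp) G w.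

Definition midx_seq (k : midx d) : seq 'I_d.+1 :=
  flatten [seq nseq (k i) i | i <- enum 'I_d.+1].

Lemma dXpowE k G : dXpow k G = dXs (midx_seq k) G.
Proof.
rewrite /dXpow /midx_seq /dXs; elim: (enum _) => //= i r ->.
by rewrite foldr_cat; elim: (k i) => //= n ->.
Qed.

Lemma dXs_0 w : dXs w (fun=> 0) = fun=> 0.
Proof. by elim: w => [|i w IH]; rewrite //= IH dX_0. Qed.

(** The exponent is a sequence, so that the product rule is an induction and lowering an exponent is
    [rem]. *)
Definition smonomial (a : seq otype) G : fn := fun x => (\prod_(o <- a) x o) * G x.

Lemma smonomial_cons o a G :
  smonomial (o :: a) G = fun x => x o * smonomial a G x.
Proof. by apply/funext => x; rewrite /smonomial big_cons mulrA. Qed.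

Lemma CO_smonomial a G : CO G -> CO (smonomial a G).
Proof.
move=> cG; elim: a => [|o a IH]; last by rewrite smonomial_cons; exact: CO_coordM.
rewrite (_ : smonomial _ _ = G)//.
by apply/funext => x; rewrite /smonomial big_nil mul1r.
Qed.

Lemma pderiv_smonomial o a G : CO G ->
  pderiv o (smonomial a G) = fun x =>
    (count_mem o a)%:R * smonomial (rem o a) G x + smonomial a (pderiv o G) x.
Proof.
move=> cG; elim: a => [|o' a IH].
  rewrite (_ : smonomial _ _ = G); last first.
    by apply/funext => x; rewrite /smonomial big_nil mul1r.
  by apply/funext => x; rewrite /smonomial big_nil mul1r mul0r add0r.
rewrite !smonomial_cons pderiv_coordM; last exact: CO_smonomial.
rewrite IH; apply/funext => x; rewrite mulrDr /=.
have [->|oo'] := eqVneq o o'; last first.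
  by rewrite add0n mul0r addr0 smonomial_cons mulrCA.
rewrite mul1r natrD mulrDl mul1r [_ + smonomial a G x]addrC addrA.
congr (_ + _ + _).
have [ina|nina] := boolP (o' \in a); last by rewrite (count_memPn nina) !mul0r mulr0.
rewrite mulrCA; congr (_ * _).
rewrite /smonomial mulrA; congr (_ * _).
by rewrite (perm_big _ (perm_to_rem ina)) big_cons.
Qed.

End Derivatives.

(** * Indices of non-vanishing derivatives *)

Section Support.
Variables (R : realType) (d : nat) (Lm Lp : finType) (s : 'I_d.+1 -> R).
Variable reg : option (label Lm Lp) -> R.
Local Notation otype := (otype d Lp).
Local Notation fn := (fn R d Lp).
Implicit Types (G H : fn) (o : otype).

Lemma coords_pderiv o G : (coords (pderiv o G) `<=` coords G)%classic.
Proof. by move=> o' H A /= GA; apply: H => /=; exact: depends_pderiv. Qed.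

(** A coordinate of positive regularity does not occur in the monomial, so its derivative falls on
    [G]; any other one is absent from [G] and must consume a factor of the monomial. This sorts [r]
    into [c] and [b]. The induction starts from the last letter because [pderivs] applies it
    first. *)
Lemma pderivs_smonomial r a G : CO G -> depends_on (Oplus s reg) G ->
  (forall o, o \in a -> Ominus s reg o) ->
  pderivs r (smonomial a G) <> (fun=> 0) ->
  exists b c : seq otype, [/\ perm_eq r (b ++ c),
    seq_mset b `<=` seq_mset a & forall o, o \in c -> coords G o].
Proof.
elim/last_ind: r a G => [|r o IH] a G cG Gp am.
  by move=> _; exists [::], [::]; split => //; apply/msubsetP => o; rewrite mset_seqE.
rewrite /pderivs -cats1 foldr_cat /= -/(pderivs _ _) pderiv_smonomial; last exact: cG.
have [op|on] := pselect (Oplus s reg o).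
  have oa : o \notin a.
    apply/negP => /am; rewrite /Ominus/= => h; move: op; rewrite /Oplus /=.
    by rewrite lt_gtF.
  rewrite (_ : (fun x => _) = smonomial a (pderiv o G)); last first.
    by apply/funext => x; rewrite (count_memPn oa) mul0r add0r.
  move=> nz; have [|b [c [rE ba cc]]] := IH _ _ (CO_pderiv o cG) _ am nz.
    exact: depends_pderiv.
  exists b, (o :: c); split => //.
    by rewrite cats1 perm_rcons perm_sym (perm_catCA b [:: o]) perm_cons perm_sym.
  move=> o'; rewrite inE => /orP[/eqP->|/cc]; last exact: coords_pderiv.
  move=> A /= GA; apply: contrapT => nA; apply: nz.
  rewrite (pderiv_notin GA nA); apply/funext => x.
  rewrite (_ : smonomial _ _ = fun=> 0) ?pderivs_0//.
  by apply/funext => y; rewrite /smonomial mulr0.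
rewrite (pderiv_notin Gp on).
have [oa|oa] := boolP (o \in a); last first.
  move=> []; rewrite (_ : (fun x => _) = fun=> 0) ?pderivs_0//.
  by apply/funext => x; rewrite (count_memPn oa) mul0r /smonomial mulr0 addr0.
rewrite (_ : (fun x => _) = fun x => (count_mem o a)%:R * smonomial (rem o a) G x);
  last by apply/funext => x; rewrite [X in _ + X]/smonomial mulr0 addr0.
rewrite pderivs_scale; last exact: CO_smonomial.
move=> nz; have [||b [c [rE ba cc]]] := IH (rem o a) G cG Gp.
  by move=> o' /mem_rem; exact: am.
  by move=> E; apply: nz; rewrite E; apply/funext => x; rewrite mulr0.
exists (o :: b), c; split => //.
  by rewrite cats1 perm_rcons /= perm_cons.
apply/msubsetP => o'; rewrite !mset_seqE.
rewrite (permP (perm_to_rem oa)) /= leq_add2l.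
by move/msubsetP : ba => /(_ o'); rewrite !mset_seqE.
Qed.

(** Some summand of the representation must have a non-zero derivative. This is the link from
    analysis to the rule: a surviving derivative yields an element of [Nhat], to which the condition
    in [Qnonlin] applies. *)
Lemma Nhat_pderivs r G : polyfn s reg G -> pderivs r G <> (fun=> 0) ->
  Nhat s reg G (seq_mset r).
Proof.
move=> [cG [l lG]] nz; have [_ lP GE] := lG.
have [x xl xnz] : exists2 x : {mset otype} * fn, x \in l &
    pderivs r (smonomial x.1 x.2) <> fun=> 0.
  apply: contrapT => h; apply: nz.
  have {}h (x : {mset otype} * fn) : x \in l -> pderivs r (smonomial x.1 x.2) = fun=> 0.
    by move=> xl; apply: contrapT => nz; apply: h; exists x.
  have -> : G = fun u => \sum_(x <- l) smonomial (x : {mset otype} * fn).1 x.2 u.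
    rewrite {1}GE; apply/funext => u; apply: eq_bigr => x _.
    by rewrite mulrC.
  rewrite pderivs_sum_seq.
    by apply/funext => u; rewrite big_seq big1// => x /h ->.
  by move=> x /lP[_ cx _ _]; exact: CO_smonomial.
have [xm cx xp _] := lP _ xl.
have [b [c [rE ba cc]]] := pderivs_smonomial cx xp xm xnz.
exists l, x, (seq_mset b), (seq_mset c); split => //.
- by move: ba; rewrite seq_mset_id.
- by move=> o; rewrite (perm_mem (perm_eq_seq_mset c)); exact: cc.
- apply/msetP => o; rewrite msetE2 !mset_seqE (permP rE) count_cat//.
Qed.

End Support.

(** * Conforming trees *)

Section GenTrees.
Variables (N E : choiceType).
Implicit Types (t : ptree N E) (tau : tree N E).

Lemma canon_val tau : Defs.canon (val tau) = val tau.
Proof. exact/eqP/(valP tau). Qed.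

Lemma mktree_val tau : mktree (val tau) = tau.
Proof. by apply: val_inj; rewrite /= canon_val. Qed.

Lemma mktree_canon t : mktree (Defs.canon t) = mktree t.
Proof. by apply: val_inj; rewrite /= canon_idem. Qed.

Lemma canon_node a (s : seq (E * ptree N E)) :
  Defs.canon (PNode a s) =
  PNode a (enum_mset (seq_mset [seq (x.1, Defs.canon x.2) | x <- s])).
Proof. by []. Qed.

Lemma node_eta t : t = PNode (rdec t) (kids t).
Proof. by case: t. Qed.

Lemma rdec_canon t : rdec (Defs.canon t) = rdec t.
Proof. by case: t. Qed.

Lemma kids_canon t :
  perm_eq (kids (Defs.canon t)) [seq (x.1, Defs.canon x.2) | x <- kids t].
Proof. by case: t => a s /=; exact: perm_eq_seq_mset. Qed.

Lemma mem_kids_canon t x : x \in kids (Defs.canon t) ->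
  exists2 y, y \in kids t & x = (y.1, Defs.canon y.2).
Proof. by rewrite (perm_mem (kids_canon t)) => /mapP[y yt ->]; exists y. Qed.

Lemma canon_kid tau x : x \in kids (val tau) -> Defs.canon x.2 = x.2.
Proof.
by rewrite -canon_val => /mem_kids_canon[y _ ->] /=; rewrite canon_idem.
Qed.

Lemma tree_eq tau sigma : rdec (val tau) = rdec (val sigma) ->
  perm_eq (kids (val tau)) (kids (val sigma)) -> tau = sigma.
Proof.
move=> ar ks; apply: val_inj; rewrite -(canon_val tau) -(canon_val sigma).
rewrite (node_eta (val tau)) (node_eta (val sigma)) !canon_node ar.
by congr PNode; congr enum_mset; apply/eq_seq_msetP/perm_map.
Qed.

Lemma mem_branches (a : N) (s : seq (E * ptree N E)) y :
  reflect (exists2 x, x \in s & y = x \/ y \in branches x.2)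
          (y \in branches (PNode a s)).
Proof.
apply: (iffP flatten_mapP) => -[x xs].
  by rewrite inE => /orP[/eqP->|yx]; exists x; auto.
by move=> [->|yx]; exists x => //; rewrite inE ?eqxx ?yx ?orbT.
Qed.

Lemma kid_branch t x : x \in kids t -> x \in branches t.
Proof. by case: t => a s xs; apply/mem_branches; exists x; [exact: xs|left]. Qed.

Lemma branch_kid t x y : x \in kids t -> y \in branches x.2 -> y \in branches t.
Proof.
by case: t => a s xs yx; apply/mem_branches; exists x; [exact: xs|right].
Qed.

End GenTrees.

Section ConformingTrees.
Variables (R : realType) (d : nat) (Lm Lp : finType).
Variables (s : 'I_d.+1 -> R) (hom : label Lm Lp -> R).
Variable rule : label Lm Lp -> set {mset etype d Lm Lp}.
Local Notation otype := (otype d Lp).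
Local Notation vtree := (vtree d Lm Lp).
Local Notation full_tree := (full_tree d Lm Lp).
Local Notation Dext := (Dext s hom rule).
Local Notation Tex := (Tex s hom rule).
Implicit Types (T : full_tree) (sigma tau : vtree) (o : otype).

Definition vkids sigma : seq (otype * vtree) :=
  [seq (x.1, mktree x.2) | x <- kids (val sigma)].

Lemma vkids_val sigma : [seq (x.1, val x.2) | x <- vkids sigma] = kids (val sigma).
Proof.
rewrite /vkids -map_comp -[RHS]map_id; apply/eq_in_map => x xs /=.
by rewrite (canon_kid xs) -surjective_pairing.
Qed.

Lemma vnode_eta sigma :
  sigma = vnode (rdec (val sigma)).1 (rdec (val sigma)).2 (vkids sigma).
Proof.
rewrite /vnode vkids_val -surjective_pairing -node_eta.
by rewrite mktree_val.
Qed.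

Lemma rdec_vnode l k r : rdec (val (@vnode d Lm Lp l k r)) = (l, k).
Proof. by []. Qed.

Lemma kids_vnode l k r :
  perm_eq (kids (val (@vnode d Lm Lp l k r))) [seq (x.1, val x.2) | x <- r].
Proof.
rewrite /= (perm_trans (perm_eq_seq_mset _))// -map_comp.
by rewrite (eq_map (g := fun x => (x.1, val x.2)))// => x /=; rewrite canon_val.
Qed.

Lemma kids_planted o sigma : kids (val (planted o sigma)) = [:: (o, val sigma)].
Proof. by apply/perm_small_eq => //; exact: (kids_vnode _ _ [:: _]). Qed.

Lemma vkids_planted o sigma : vkids (planted o sigma) = [:: (o, sigma)].
Proof. by rewrite /vkids kids_planted /= mktree_val. Qed.

Lemma planted_inj o : injective (@planted d Lm Lp o).
Proof. by move=> x y /(congr1 vkids); rewrite !vkids_planted => -[]. Qed.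

(** [Tex] leaves the type at the root existential, whereas a branch has to conform at the type of
    its own edge. Here the type is a parameter; [rule t (out T)] is part of [Dext]. *)
Definition conforming (t : label Lm Lp) T : Prop :=
  [/\ Dext t (out T) (rdec T).2,
      forall x, x \in branches T -> rule x.1.1 (out x.2),
      forall x, x \in branches T -> is_inl x.1.1 -> (rdec x.2).1 = 0 &
      forall x, x \in branches T -> Dext x.1.1 (out x.2) (rdec x.2).2].

Definition Tex_at (t : label Lm Lp) : set vtree :=
  [set sigma | exists T, conforming t T /\ sigma = mktree (prune T)].

Lemma Tex_at_Tex t sigma : Tex_at t sigma -> Tex sigma.
Proof.
move=> [T [[DT Rb nb Db] ->]]; exists T; split => //.
split => //; last by exists t.
by split => //; exists t; case: DT.
Qed.

Lemma Tex_Tex_at sigma : Tex sigma -> exists t, Tex_at t sigma.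
Proof. by move=> [T [[[_ Rb] nb Db [t Dt]] ->]]; exists t, T; split. Qed.

Lemma kids_prune T x : x \in kids (prune T) ->
  exists2 y, ((inr x.1.1, x.1.2), y) \in kids T & x.2 = prune y.
Proof.
case: T => -[n o] r /=; elim: r => //= -[[[l|t] p] T] r IH /=.
  by move=> /IH[y yr ->]; exists y => //; rewrite inE yr orbT.
rewrite inE => /orP[/eqP-> /=|/IH[y yr ->]]; first by exists T => //; exact: mem_head.
by exists y => //; rewrite inE yr orbT.
Qed.

Lemma Tex_at_vkids t sigma x : Tex_at t sigma -> x \in vkids sigma ->
  Tex_at (inr x.1.1) x.2.
Proof.
move=> [T [[_ Rb nb Db] ->]] /mapP[z] /mem_kids_canon[y] /kids_prune[T' yT yE] -> ->.
exists T'; rewrite /= mktree_canon yE; split => //.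
have sub u : u \in branches T' -> u \in branches T.
  by move=> uT; apply: branch_kid yT _.
split.
- exact: (Db _ (kid_branch yT)).
- by move=> u /sub; exact: Rb.
- by move=> u /sub; exact: nb.
- by move=> u /sub; exact: Db.
Qed.

Lemma planted_Tex_at o sigma : Tex (planted o sigma) -> Tex_at (inr o.1) sigma.
Proof.
move=> /Tex_Tex_at[t] /Tex_at_vkids; rewrite vkids_planted.
by move=> /(_ (o, sigma)); apply; exact: mem_head.
Qed.

(** The new root carries zero decorations, and 0 lies in [Dext] as soon as the rule allows the
    node. *)
Lemma Tex_at_planted t t' sigma :
  rule t' [mset ((inr t, 0) : etype d Lm Lp)] -> Tex_at (inr t) sigma ->
  Tex (planted (t, 0) sigma).
Proof.
move=> rt [T [[DT Rb nb Db] sE]].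
pose T0 : full_tree := PNode (0, 0) [:: ((inr t, 0), T)].
have outT0 : out T0 = [mset ((inr t, 0) : etype d Lm Lp)].
  by apply/msetP => x; rewrite mset_seqE msetnE /= addn0 eq_sym; case: eqP.
have bT0 x : x \in branches T0 -> x = ((inr t, 0), T) \/ x \in branches T.
  by move=> /mem_branches[y]; rewrite inE => /eqP ->.
apply: (@Tex_at_Tex t'); exists T0; split.
  split.
  - by rewrite outT0; split => //; left.
  - by move=> x /bT0[->|/Rb//]; case: DT.
  - by move=> x /bT0[->|/nb//].
  - by move=> x /bT0[->|/Db//].
apply: tree_eq; rewrite ?rdec_vnode ?kids_planted.
  congr (_, _, _); apply/esym.
  by apply/msetP => x; rewrite mset_seqE mset0E.
by rewrite perm_sym /= (perm_trans (perm_eq_seq_mset _))//= sE.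
Qed.

Lemma rdec_prune T : (rdec (prune T)).1.2 = (rdec T).2.
Proof. by case: T => -[]. Qed.

(** Pruning loses nothing about the root, since the driver records the removed edges. *)
Lemma out_prune T : out T =
  seq_mset [seq etype_of_o Lm o | o <- seq_mset (unzip1 (kids (Defs.canon (prune T))))]
  `+` noise Lp (rdec (prune T)).1.1.
Proof.
apply/msetP => a; rewrite msetE2 !mset_seqE.
have /permP -> : perm_eq
    [seq etype_of_o Lm o | o <- seq_mset (unzip1 (kids (Defs.canon (prune T))))]
    [seq etype_of_o Lm o | o <- unzip1 (kids (prune T))].
  apply: perm_map; rewrite (perm_trans (perm_eq_seq_mset _))//.
  rewrite (perm_trans (perm_map _ (kids_canon _)))// -map_comp.
  by rewrite (eq_map (g := fst)).
case: T => -[n o] r /=.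
have /permP -> : perm_eq [seq etype_of_noise Lp e | e <- seq_mset (pmap
     (fun x : etype d Lm Lp * full_tree => match x.1 with
       | (inl l, p) => Some (l, p) | (inr _, p) => None end) r)]
   [seq etype_of_noise Lp e | e <- pmap
     (fun x : etype d Lm Lp * full_tree => match x.1 with
       | (inl l, p) => Some (l, p) | (inr _, p) => None end) r].
  by apply: perm_map; exact: perm_eq_seq_mset.
elim: r => //= -[[[l|t] p] T] r IH /=; rewrite IH.
  by rewrite addnCA.
by rewrite addnA.
Qed.

(** The full tree witnessing [Tex] is kept, even if its root conforms at another type: the
    conditions above the root do not involve [t], and by [out_prune] the one at the root can be read
    off [sigma]. *)
Lemma Tex_at_Dext t sigma : Tex sigma ->
  Dext t (seq_mset [seq etype_of_o Lm o | o <- seq_mset (unzip1 (kids (val sigma)))]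
    `+` noise Lp (rdec (val sigma)).1.1) (rdec (val sigma)).1.2 ->
  Tex_at t sigma.
Proof.
move=> [T [[[_ Rb] nb Db _] sE]] h; exists T; split => //; split => //.
by rewrite out_prune -rdec_prune; move: h; rewrite sE /= rdec_canon.
Qed.

Fixpoint psize (t : ptree (driver d Lm Lp * midx d) otype) : nat :=
  let: PNode a r := t in
  (mabs a.2 + foldr (fun x c => (psize x.2).+1 + c) 0 r)%N.

Lemma psizeE t : psize t =
  (size (edges t) + \sum_(x <- nodes t) mabs (rdec x).2)%N.
Proof.
elim/ptree_ind_seq: t => a r IH; rewrite /nodes /edges big_cons /=.
rewrite addnCA; congr (_ + _)%N.
elim: r IH => [|x r IHr] /=; first by rewrite /unzip2 big_nil.
move=> [IHx /IHr ->]; rewrite IHx /unzip1 /unzip2 /= !map_cat size_cat.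
rewrite big_cons big_cat /nodes big_cons /= /edges !size_map.
by rewrite !addSn addnACA !addnA.
Qed.

Lemma LsizeE sigma : Lsize sigma = psize (val sigma).
Proof. by rewrite psizeE. Qed.

Lemma Lsize_vkids sigma x : x \in vkids sigma -> (Lsize x.2 < Lsize sigma)%N.
Proof.
move=> /mapP[y ys ->]; rewrite !LsizeE -[val _]/(Defs.canon y.2) (canon_kid ys).
case: (val sigma) ys => a r /=; elim: r => //= z r IH.
rewrite inE => /orP[/eqP ->|/IH h]; first by rewrite addnS ltnS addnCA leq_addr.
by rewrite (leq_trans h)// leq_add2l leq_addl.
Qed.

Lemma Lsize_planted o sigma : Lsize (planted o sigma) = (Lsize sigma).+1.
Proof.
rewrite !LsizeE [val (planted _ _)]node_eta kids_planted rdec_vnode /= addn0.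
by rewrite /mabs big1// => i _; rewrite ffunE.
Qed.

End ConformingTrees.

(** * Products of tree series *)

Section Shuffle.
Variables (R : realType) (X : eqType).
Implicit Types (f g h : seq X -> R) (w v : seq X).

(* Exponential generating functions in the letters of [X]: [f w] is the iterated
   derivative of a formal series along the letters of [w], so that the product
   of series obeys the Leibniz rule below. *)
Fixpoint shuf_rec w f g : R :=
  if w is a :: v then
    shuf_rec v (fun u => f (a :: u)) g + shuf_rec v f (fun u => g (a :: u))
  else f [::] * g [::].
Definition shuf f g : seq X -> R := fun w => shuf_rec w f g.

Definition shuf1 : seq X -> R := fun w => (w == [::])%:R.

Lemma shuf_cons f g a w : shuf f g (a :: w) =
  shuf (fun u => f (a :: u)) g w + shuf f (fun u => g (a :: u)) w.
Proof. by []. Qed.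

Lemma shufDl f f' g w : shuf (fun v => f v + f' v) g w = shuf f g w + shuf f' g w.
Proof.
elim: w f f' g => [|a w IH] f f' g; first by rewrite /shuf /= mulrDl.
by rewrite !shuf_cons !IH addrACA.
Qed.

Lemma shufDr f g g' w : shuf f (fun v => g v + g' v) w = shuf f g w + shuf f g' w.
Proof.
elim: w f g g' => [|a w IH] f g g'; first by rewrite /shuf /= mulrDr.
by rewrite !shuf_cons !IH addrACA.
Qed.

Lemma shufZl c f g w : shuf (fun v => c * f v) g w = c * shuf f g w.
Proof.
elim: w f g => [|a w IH] f g; first by rewrite /shuf /= mulrA.
by rewrite !shuf_cons !IH mulrDr.
Qed.

Lemma shufZr c f g w : shuf f (fun v => c * g v) w = c * shuf f g w.
Proof.
elim: w f g => [|a w IH] f g; first by rewrite /shuf /= mulrCA.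
by rewrite !shuf_cons !IH mulrDr.
Qed.

Lemma shuf0l g w : shuf (fun=> 0) g w = 0.
Proof.
elim: w g => [|a w IH] g; first by rewrite /shuf /= mul0r.
by rewrite !shuf_cons !IH addr0.
Qed.

Lemma shuf0r f w : shuf f (fun=> 0) w = 0.
Proof.
elim: w f => [|a w IH] f; first by rewrite /shuf /= mulr0.
by rewrite !shuf_cons !IH addr0.
Qed.

Lemma shuf1l g w : shuf shuf1 g w = g w.
Proof.
elim: w g => [|a w IH] g; first by rewrite /shuf /= mul1r.
by rewrite !shuf_cons IH shuf0l add0r.
Qed.

Lemma shuf_sumr (I : Type) (r : seq I) f (g : I -> seq X -> R) w :
  shuf f (fun v => \sum_(i <- r) g i v) w = \sum_(i <- r) shuf f (g i) w.
Proof.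
elim: r => [|i r IH].
  rewrite big_nil (_ : (fun v => _) = fun=> 0) ?shuf0r//.
  by apply/funext => v; rewrite big_nil.
rewrite big_cons -IH -shufDr; congr (shuf _ _ _).
by apply/funext => v; rewrite big_cons.
Qed.

(** Both sides expand into the same three terms, according to the factor that receives the letter.
    This is the form of commutativity that permutes the factors of a right-nested product. *)
Lemma shufCA f g h w : shuf f (shuf g h) w = shuf g (shuf f h) w.
Proof.
elim: w f g h => [|a w IH] f g h; first by rewrite /shuf /= mulrCA.
rewrite [LHS]shuf_cons [RHS]shuf_cons.
have E f' g' : (fun u => shuf f' g' (a :: u)) = fun u =>
    shuf (fun v => f' (a :: v)) g' u + shuf f' (fun v => g' (a :: v)) u by [].
by rewrite !E !shufDr IH (IH f) (IH f g) addrCA.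
Qed.

Lemma shuf_eq0 n f g w : (forall v, (size v < n)%N -> g v = 0) ->
  (size w < n)%N -> shuf f g w = 0.
Proof.
elim: w n f g => [|a w IH] n f g gn wn; first by rewrite /shuf /= gn ?mulr0.
rewrite shuf_cons (IH n)//; last exact: ltnW.
rewrite add0r (IH n.-1)//; last by case: n wn {gn}.
by move=> v vn; apply: gn => /=; case: n vn {wn}.
Qed.

(** A factor without constant term raises the order of vanishing by one; hence a product of n
    increments vanishes on words shorter than n. *)
Lemma shuf_eq0S n f g w : f [::] = 0 -> (forall v, (size v < n)%N -> g v = 0) ->
  (size w < n.+1)%N -> shuf f g w = 0.
Proof.
elim: w n f g => [|a w IH] n f g f0 gn wn; first by rewrite /shuf /= f0 mul0r.
rewrite shuf_cons (shuf_eq0 (n := n))// add0r.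
case: n gn wn => [|n] gn wn; first by [].
by apply: (IH n) => // v vn; exact: gn.
Qed.

End Shuffle.

(** * Trees without root driver as commutative monomials *)

Section TreeWords.
Variables (R : realType) (d : nat) (Lm Lp : finType).
Local Notation otype := (otype d Lp).
Local Notation vtree := (vtree d Lm Lp).
Local Notation fseries := (fseries R d Lm Lp).
Implicit Types (sigma tau x y : vtree) (o : otype) (f g : fseries).

Local Notation atom := ('I_d.+1 + otype * vtree)%type.
Implicit Types (a b : atom) (w : seq atom).

Definition atree a : vtree :=
  match a with inl i => Xpow Lm Lp (munit i) | inr (o, tau) => planted o tau end.

Definition atom_count a sigma : nat :=
  match a with
  | inl i => (rdec (val sigma)).2 i
  | inr (o, tau) => count_mem (o, val tau) (kids (val sigma))
  end.

Definition wtree w : vtree := foldr (fun a => tjoin (atree a)) (tone d Lm Lp) w.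

(** The product of the factorials of the multiplicities, arranged so that prefixing a letter
    contributes the constant of [atom_deriv]. *)
Fixpoint word_fact w : nat :=
  if w is a :: v then ((atom_count a (wtree v)).+1 * word_fact v)%N else 1%N.

Definition nodriver sigma : bool := (rdec (val sigma)).1 == driver0 d Lm Lp.

Lemma rdec_tjoin x y : rdec (val (tjoin x y)) =
  (driverD (rdec (val x)).1 (rdec (val y)).1, (rdec (val x)).2 + (rdec (val y)).2).
Proof. by []. Qed.

Lemma map_canon_kids x :
  [seq (z.1, Defs.canon z.2) | z <- kids (val x)] = kids (val x).
Proof.
rewrite -[RHS]map_id; apply/eq_in_map => z zx.
by rewrite (canon_kid zx) -surjective_pairing.
Qed.

Lemma kids_tjoin x y :
  perm_eq (kids (val (tjoin x y))) (kids (val x) ++ kids (val y)).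
Proof. by rewrite (perm_trans (kids_canon _))//= map_cat !map_canon_kids. Qed.

Lemma kids_vnode0 l k : kids (val (@vnode d Lm Lp l k [::])) = [::].
Proof. exact/perm_nilP/(kids_vnode l k [::]). Qed.

Lemma driverDC (l l' : driver d Lm Lp) : driverD l l' = driverD l' l.
Proof. by rewrite /driverD msetDC addrC. Qed.

Lemma driver0D (l : driver d Lm Lp) : driverD (driver0 d Lm Lp) l = l.
Proof. by case: l => a b; rewrite /driverD /= mset0D add0r. Qed.

Lemma driverDI (l : driver d Lm Lp) : injective (driverD l).
Proof.
case: l => [A e] [B e'] [C e''] E.
have /addrI -> : e + e' = e + e'' by exact: (congr1 snd E).
have AB : A `+` B = A `+` C by exact: (congr1 fst E).
by have := congr1 (msetB^~ A) AB; rewrite !msetDKB => ->.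
Qed.

Lemma tjoinC x y : tjoin x y = tjoin y x.
Proof.
apply: tree_eq; first by rewrite !rdec_tjoin driverDC addrC.
rewrite (perm_trans (kids_tjoin _ _))// perm_catC perm_sym.
exact: kids_tjoin.
Qed.

Lemma tone_tjoin x : tjoin (tone d Lm Lp) x = x.
Proof.
apply: tree_eq.
  by rewrite rdec_tjoin rdec_vnode driver0D add0r -surjective_pairing.
by rewrite (perm_trans (kids_tjoin _ _))// kids_vnode0.
Qed.

Lemma tjoinA x y z : tjoin x (tjoin y z) = tjoin (tjoin x y) z.
Proof.
apply: tree_eq.
  by rewrite !rdec_tjoin /driverD /= msetDA !addrA.
rewrite (perm_trans (kids_tjoin _ _))// perm_sym (perm_trans (kids_tjoin _ _))//.
rewrite perm_sym (perm_trans (perm_cat (perm_refl _) (kids_tjoin _ _)))//.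
by rewrite catA perm_cat// perm_sym kids_tjoin.
Qed.

Lemma tjoinCA x y z : tjoin x (tjoin y z) = tjoin y (tjoin x z).
Proof. by rewrite !tjoinA (tjoinC x). Qed.

Lemma midx_addI (k : midx d) : injective (+%R k).
Proof.
move=> p q /ffunP E; apply/ffunP => i; move: (E i); rewrite !ffunE.
exact: addnI.
Qed.

Lemma tjoinI x : injective (tjoin x).
Proof.
move=> y z yz; apply: tree_eq.
  have E := congr1 (fun t => rdec (val t)) yz; rewrite !rdec_tjoin in E.
  have /driverDI := congr1 fst E; have /midx_addI := congr1 snd E.
  by case: (rdec (val y)) (rdec (val z)) => [a b] [a' b'] /= -> ->.
have := kids_tjoin x z; rewrite -yz perm_sym => h.
by have := perm_trans h (kids_tjoin x y); rewrite perm_cat2l perm_sym.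
Qed.

Lemma atom_count_tjoin a x y : atom_count a (tjoin x y) = (atom_count a x + atom_count a y)%N.
Proof.
case: a => [i|[q tau]]; rewrite /atom_count; first by rewrite rdec_tjoin /= ffunE.
by rewrite (permP (kids_tjoin x y)) count_cat.
Qed.

Lemma atom_count_atree a b : atom_count a (atree b) = (a == b).
Proof.
case: a b => [i|[q tau]] [j|[q1 tau1]]; rewrite /atom_count /atree ?rdec_vnode.
- by rewrite ffunE.
- by rewrite ffunE.
- by rewrite kids_vnode0.
- rewrite kids_planted /= addn0 xpair_eqE (inj_eq val_inj) -xpair_eqE.
  by rewrite eq_sym.
Qed.

Lemma atom_count_tone a : atom_count a (tone d Lm Lp) = 0%N.
Proof. by case: a => [i|[q tau]]; rewrite /atom_count ?kids_vnode0// ffunE. Qed.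

Lemma atom_count_gt0 a x : (0 < atom_count a x)%N -> exists y, x = tjoin (atree a) y.
Proof.
case: a => [i|[q tau]] /= ax.
  exists (vnode (rdec (val x)).1 [ffun j => ((rdec (val x)).2 j - munit i j)%N] (vkids x)).
  rewrite [LHS]vnode_eta; apply: tree_eq.
    rewrite rdec_tjoin !rdec_vnode driver0D; congr (_, _).
    apply/ffunP => j; rewrite !ffunE.
    by case: eqP => [->|_]; [exact/esym/subnKC|rewrite subn0 add0r].
  rewrite (perm_trans (kids_vnode _ _ _))// perm_sym.
  rewrite (perm_trans (kids_tjoin _ _))// kids_vnode0.
  exact: kids_vnode.
have xin : (q, tau) \in vkids x.
  rewrite -has_pred1 has_count.
  have : (0 < count_mem (q, val tau) [seq (z.1, val z.2) | z <- vkids x])%N.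
    by rewrite vkids_val.
  rewrite count_map => /leq_trans; apply; apply: sub_count => -[q1 t] /=.
  by rewrite !xpair_eqE (inj_eq val_inj).
exists (vnode (rdec (val x)).1 (rdec (val x)).2 (rem (q, tau) (vkids x))).
rewrite [LHS]vnode_eta; apply: tree_eq.
  by rewrite rdec_tjoin !rdec_vnode driver0D add0r.
rewrite (perm_trans (kids_vnode _ _ _))// perm_sym.
rewrite (perm_trans (kids_tjoin _ _))// kids_planted.
have h := perm_map (fun z : otype * vtree => (z.1, val z.2)) (perm_to_rem xin).
rewrite perm_sym (perm_trans h)// map_cons cat1s perm_cons perm_sym.
exact: kids_vnode.
Qed.

Lemma nodriver_atree a : nodriver (atree a).
Proof. by case: a => [i|[q tau]]; rewrite /nodriver rdec_vnode. Qed.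

Lemma nodriver_tjoin x y : nodriver x -> nodriver (tjoin x y) = nodriver y.
Proof. by rewrite /nodriver rdec_tjoin => /eqP -> /=; rewrite driver0D. Qed.

Lemma nodriverP x : nodriver x -> (rdec (val x)).1 = driver0 d Lm Lp.
Proof. by move/eqP. Qed.

Lemma nodriver_cons a x : nodriver (tjoin (atree a) x) = nodriver x.
Proof. exact: (nodriver_tjoin x (nodriver_atree a)). Qed.

Lemma nodriver_tone : nodriver (tone d Lm Lp).
Proof. exact: eqxx. Qed.

#[local] Opaque tjoin nodriver.

Lemma nodriver_wtree w : nodriver (wtree w).
Proof.
elim: w => [|a w IH]; first exact: nodriver_tone.
by rewrite nodriver_cons.
Qed.

(* Factorisations into trees without driver at the root: there are infinitely
   many others, as root drivers are added. *)
Definition factors sigma : set (vtree * vtree) :=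
  [set x | [/\ nodriver x.1, nodriver x.2 & tjoin x.1 x.2 = sigma]].

Lemma factors_swap sigma (x : vtree * vtree) : factors sigma x -> factors sigma (x.2, x.1).
Proof.
by case=> nx ny E; split; [exact: ny|exact: nx|rewrite -E; exact: tjoinC].
Qed.

Lemma factors_tone (x : vtree * vtree) :
  factors (tone d Lm Lp) x -> x = (tone d Lm Lp, tone d Lm Lp).
Proof.
case: x => x y [/= nx ny xy]; have x0 := nodriverP nx; have y0 := nodriverP ny.
have := kids_tjoin x y; rewrite xy kids_vnode0 perm_sym => /perm_nilP.
case kx : (kids (val x)) => //; case ky : (kids (val y)) => // _.
have : (rdec (val (tjoin x y))).2 = 0 by rewrite xy.
rewrite rdec_tjoin /= => k0.
have [k1 k2] : (rdec (val x)).2 = 0 /\ (rdec (val y)).2 = 0.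
  split; apply/ffunP => i; have /ffunP/(_ i) := k0; rewrite !ffunE => /eqP.
    by rewrite addn_eq0 => /andP[/eqP].
  by rewrite addn_eq0 => /andP[_ /eqP].
congr (_, _); apply: tree_eq; rewrite ?kx ?ky ?kids_vnode0//.
  by rewrite (surjective_pairing (rdec (val x))) x0 k1.
by rewrite (surjective_pairing (rdec (val y))) y0 k2.
Qed.

(** Letters behave like primes: [atom_count] is additive, so [a] occurs in one of the factors, and
    cancelling it there by [tjoinI] leaves a factorisation of [sigma]. *)
Lemma factors_cons a sigma (x : vtree * vtree) : factors (tjoin (atree a) sigma) x ->
  (exists2 y, factors sigma y & x = (tjoin (atree a) y.1, y.2)) \/
  (exists2 y, factors sigma y & x = (y.1, tjoin (atree a) y.2)).
Proof.
case: x => x y [/= nx ny xy].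
have : (0 < atom_count a x + atom_count a y)%N.
  by rewrite -atom_count_tjoin xy atom_count_tjoin atom_count_atree eqxx.
have aux u z : nodriver u -> u = tjoin (atree a) z -> nodriver z.
  by move=> + uE; rewrite uE nodriver_cons.
rewrite addn_gt0 => /orP[] /atom_count_gt0[z zE].
  left; exists (z, y); last by rewrite zE.
  split; [exact: aux nx zE|exact: ny|].
  by apply: (@tjoinI (atree a)); rewrite tjoinA -zE.
right; exists (x, z); last by rewrite zE.
split; [exact: nx|exact: aux ny zE|].
by apply: (@tjoinI (atree a)); rewrite tjoinCA -zE.
Qed.

(** Each letter goes to the left or to the right factor. Finiteness is what allows sums over
    factorisations to be split in the Leibniz rule. *)
Lemma finite_factors w : finite_set (factors (wtree w)).
Proof.
elim: w => [|a w IH].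
  apply: (@sub_finite_set _ _ [set (tone d Lm Lp, tone d Lm Lp)]) => //.
  by move=> x /factors_tone.
apply: (@sub_finite_set _ _ (
  ((fun y : vtree * vtree => (tjoin (atree a) y.1, y.2)) @` factors (wtree w)) `|`
  ((fun y : vtree * vtree => (y.1, tjoin (atree a) y.2)) @` factors (wtree w)))%classic).
  by move=> x /factors_cons[[y yf ->]|[y yf ->]]; [left|right]; exists y.
by rewrite finite_setU; split; exact: finite_image.
Qed.

Definition nodriver_supp f : Prop := forall sigma, ~~ nodriver sigma -> f sigma = 0.

Lemma smulE f g sigma : nodriver_supp f -> nodriver_supp g ->
  smul f g sigma = \sum_(x \in factors sigma) f x.1 * g x.2.
Proof.
move=> f0 g0; apply/esym/fsbig_widen; first by move=> x [].
move=> [x y] [/= xy nf].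
have [nx|nx] := boolP (nodriver x); last by rewrite f0 ?mul0r.
have [ny|ny] := boolP (nodriver y); last by rewrite g0 ?mulr0.
by case: nf; split; [exact: nx|exact: ny|exact: xy].
Qed.

Lemma smulC f g sigma : nodriver_supp f -> nodriver_supp g ->
  smul f g sigma = smul g f sigma.
Proof.
move=> f0 g0; rewrite !smulE//.
rewrite (@reindex_fsbig _ _ _ _ _ (fun x : vtree * vtree => (x.2, x.1)) (factors sigma)).
  by apply: eq_fsbigr => x _; rewrite mulrC.
split; first by move=> x; exact: factors_swap.
  by move=> [x y] [x' y'] _ _ E; rewrite (congr1 snd E : x = x') (congr1 fst E : y = y').
by move=> [x y] xy; exists (y, x) => //; exact: (factors_swap xy).
Qed.

(** The formal partial derivative in the variable [a], which sends a^(m+1) to (m+1) a^m. *)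
Definition atom_deriv a f : fseries :=
  fun sigma => (atom_count a sigma).+1%:R * f (tjoin (atree a) sigma).

Lemma atom_deriv_supp a f : nodriver_supp f -> nodriver_supp (atom_deriv a f).
Proof.
move=> f0 x nx; rewrite /atom_deriv f0; first by rewrite mulr0.
by rewrite nodriver_cons.
Qed.

Lemma smul_supp f g : nodriver_supp f -> nodriver_supp g -> nodriver_supp (smul f g).
Proof.
move=> f0 g0 x nx; rewrite smulE// fsbig1// => -[y z] [/= ny nz E].
by move: nx; rewrite -E (nodriver_tjoin _ ny) nz.
Qed.

(** Attaching [a] to the first factor embeds the factorisations of [sigma] into those on the
    right-hand side; the pairs missed have no [a] in their first factor, so their weight is 0. *)
Lemma smul_atom_deriv a f g sigma : nodriver_supp f -> nodriver_supp g ->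
  smul (atom_deriv a f) g sigma =
  \sum_(x \in factors (tjoin (atree a) sigma)) (atom_count a x.1)%:R * (f x.1 * g x.2).
Proof.
move=> f0 g0; rewrite smulE//; last exact: atom_deriv_supp.
pose h (y : vtree * vtree) := (tjoin (atree a) y.1, y.2).
transitivity (\sum_(x \in h @` factors sigma) (atom_count a x.1)%:R * (f x.1 * g x.2)).
  rewrite fsbig_image; last first.
    move=> [x y] [x' y'] _ _ E.
    by rewrite (tjoinI (congr1 fst E : tjoin _ x = tjoin _ x')) (congr1 snd E : y = y').
  apply: eq_fsbigr => -[x y] _.
  by rewrite /atom_deriv /= atom_count_tjoin atom_count_atree eqxx mulrA.
apply: fsbig_widen.
  move=> _ [[x y] [/= nx ny <-] <-]; split; rewrite /= ?nodriver_cons//.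
  by rewrite tjoinA.
move=> [x y] [[/= nx ny xy] nh].
case: (posnP (atom_count a x)) => [->|/atom_count_gt0[z zE]]; first by rewrite mul0r.
case: nh; exists (z, y); last by rewrite /h zE.
split; [by rewrite -(nodriver_cons a) -zE|exact: ny|].
by apply: (@tjoinI (atree a)); rewrite tjoinA -zE.
Qed.

Lemma smul_Leibniz a f g w : nodriver_supp f -> nodriver_supp g ->
  atom_deriv a (smul f g) (wtree w) =
  smul (atom_deriv a f) g (wtree w) + smul f (atom_deriv a g) (wtree w).
Proof.
move=> f0 g0; rewrite [X in _ + X]smulC//; last exact: atom_deriv_supp.
rewrite !smul_atom_deriv// /atom_deriv smulE//.
set P := factors _; have finP : finite_set P by exact: (finite_factors (a :: w)).
have -> : \sum_(x \in P) (atom_count a x.1)%:R * (g x.1 * f x.2) =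
    \sum_(x \in P) (atom_count a x.2)%:R * (f x.1 * g x.2).
  rewrite (@reindex_fsbig _ _ _ _ _ (fun x : vtree * vtree => (x.2, x.1)) P).
    by apply: eq_fsbigr => x _; rewrite [g _ * _]mulrC.
  split; first by move=> x; exact: factors_swap.
    by move=> [x y] [x' y'] _ _ E; rewrite (congr1 snd E : x = x') (congr1 fst E : y = y').
  by move=> [x y] xy; exists (y, x) => //; exact: (factors_swap xy).
(* The multiplicities of [a] in the two factors add up to its multiplicity in the product, which is
   the constant in [atom_deriv]. *)
rewrite -fsbig_split//= mulr_fsumr; apply: eq_fsbigr => x /set_mem[_ _ xE].
by rewrite -mulrDl -natrD -atom_count_tjoin xE atom_count_tjoin atom_count_atree eqxx.
Qed.

Definition wcoef f : seq atom -> R := fun w => (word_fact w)%:R * f (wtree w).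

Lemma wcoef_cons a f w : wcoef f (a :: w) = wcoef (atom_deriv a f) w.
Proof. by rewrite /wcoef /atom_deriv [word_fact _]/= natrM -mulrA mulrCA. Qed.

(** Both sides obey the same Leibniz recursion, and the trivial tree has a single factorisation. *)
Lemma wcoef_smul f g w : nodriver_supp f -> nodriver_supp g ->
  wcoef (smul f g) w = shuf (wcoef f) (wcoef g) w.
Proof.
elim: w f g => [|a w IH] f g f0 g0.
  rewrite /wcoef /shuf [word_fact _]/= [wtree _]/= [shuf_rec _ _ _]/= !mul1r smulE//.
  rewrite (@eq_fsbigl _ _ _ _ _ _ [set (tone d Lm Lp, tone d Lm Lp)]) ?fsbig_set1//.
  apply/seteqP; split=> x; first by move/factors_tone.
  move=> ->; split; [exact: nodriver_tone|exact: nodriver_tone|exact: tone_tjoin].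
rewrite wcoef_cons /wcoef smul_Leibniz// mulrDr -!/(wcoef _ _).
rewrite !IH//; try exact: atom_deriv_supp.
rewrite [RHS]shuf_cons.
have E h : (fun u => wcoef h (a :: u)) = wcoef (atom_deriv a h).
  by apply/funext => v; rewrite wcoef_cons.
by rewrite !E.
Qed.

Lemma deltat_tone_supp : nodriver_supp (deltat R (tone d Lm Lp)).
Proof.
move=> x nx; rewrite /deltat; case: eqP => // E.
by rewrite E nodriver_tone in nx.
Qed.

Lemma wcoef_tone w : wcoef (deltat R (tone d Lm Lp)) w = shuf1 R w.
Proof.
rewrite /wcoef /deltat /shuf1; case: w => [|a w]; first by rewrite eqxx mulr1.
case: eqP => [E|_]; last by rewrite mulr0.
have := atom_count_tone a; rewrite -E [wtree _]/= atom_count_tjoin atom_count_atree eqxx.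
by [].
Qed.

Lemma sprod_supp (r : seq fseries) : (forall f, List.In f r -> nodriver_supp f) ->
  nodriver_supp (sprod r).
Proof.
elim: r => [|f r IH] h; first exact: deltat_tone_supp.
apply: smul_supp; first by apply: h; left.
by apply: IH => g gr; apply: h; right.
Qed.

Lemma wcoef_sprod (r : seq fseries) : (forall f, List.In f r -> nodriver_supp f) ->
  wcoef (sprod r) = foldr (@shuf R _) (@shuf1 R _) [seq wcoef f | f <- r].
Proof.
elim: r => [|f r IH] h; apply/funext => w; first exact: wcoef_tone.
have fr g : List.In g r -> nodriver_supp g by move=> gr; apply: h; right.
rewrite wcoef_smul ?IH//; first by apply: h; left.
exact: sprod_supp.
Qed.

End TreeWords.

(** * Symmetry factors *)

Section Multiplicity.
Variable X : eqType.
Implicit Types (a : X) (w : seq X).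

Fixpoint seq_fact w : nat :=
  if w is a :: v then ((count_mem a v).+1 * seq_fact v)%N else 1%N.

Lemma seq_factE w : seq_fact w = (\prod_(a <- undup w) (count_mem a w)`!)%N.
Proof.
elim: w => [|a w IH]; first by rewrite big_nil.
rewrite /= IH; case: ifP => aw.
  have aw1 : a \in undup w by rewrite mem_undup aw.
  rewrite (bigD1_seq a)//= ?undup_uniq// [RHS](bigD1_seq a)//= ?undup_uniq//.
  rewrite eqxx add1n factS -mulnA; congr (_ * (_ * _))%N.
  by apply: eq_bigr => b ba; rewrite eq_sym (negPf ba).
rewrite big_cons /= eqxx (count_memPn _) ?aw// mul1n.
have -> : ((1 + 0)`! = 1)%N by [].
rewrite mul1n; apply: eq_big_seq => b; rewrite mem_undup => bw.
by case: eqP => // ab; rewrite ab bw in aw.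
Qed.

Lemma perm_seq_fact w v : perm_eq w v -> seq_fact w = seq_fact v.
Proof.
move=> wv; rewrite !seq_factE (perm_big _ (perm_undup (perm_mem wv))).
by apply: eq_bigr => a _; rewrite (permP wv).
Qed.

End Multiplicity.

Lemma seq_fact_map (X Y : eqType) (f : X -> Y) w : injective f ->
  seq_fact (map f w) = seq_fact w.
Proof.
move=> fI; elim: w => //= a w ->; congr (_.+1 * _)%N.
by rewrite count_map; apply: eq_count => b /=; rewrite (inj_eq fI).
Qed.

Lemma seq_fact_cat_sum (X Y : eqType) (r : seq X) (w : seq Y) :
  seq_fact (map inr w ++ map inl r) = (seq_fact w * seq_fact r)%N.
Proof.
have iI : injective (@inl X Y) by move=> ? ? [].
elim: w => [|b w IH]; first by rewrite mul1n; exact: seq_fact_map.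
rewrite [LHS]/= IH mulnA; congr (_.+1 * _ * _)%N.
rewrite count_cat !count_map [X in (_ + X)%N](_ : _ = 0%N) ?addn0//.
by rewrite -(count_pred0 r); exact: eq_count.
Qed.

Lemma count_map_inl (X Y : eqType) (c : X + Y) (r : seq X) :
  count_mem c (map inl r) = if c is inl a then count_mem a r else 0%N.
Proof.
by rewrite count_map; case: c => a; [exact: eq_count|elim: r].
Qed.

Lemma count_map_inr (X Y : eqType) (c : X + Y) (r : seq Y) :
  count_mem c (map inr r) = if c is inr a then count_mem a r else 0%N.
Proof.
by rewrite count_map; case: c => a; [elim: r|exact: eq_count].
Qed.

Section Trees.
Variables (R : realType) (d : nat) (Lm Lp : finType).
Local Notation otype := (otype d Lp).
Local Notation vtree := (vtree d Lm Lp).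
Local Notation fseries := (fseries R d Lm Lp).
Local Notation atom := ('I_d.+1 + otype * vtree)%type.
Implicit Types (sigma tau x y : vtree) (o : otype) (f g : fseries) (k : midx d).
Implicit Types (a b : atom) (w : seq atom).

Lemma atom_count_wtree a w : atom_count a (wtree w) = count_mem a w.
Proof.
elim: w => [|b w IH]; first exact: atom_count_tone.
by rewrite [wtree _]/= atom_count_tjoin atom_count_atree IH /= eq_sym.
Qed.

Lemma word_factE w : word_fact w = seq_fact w.
Proof. by elim: w => //= a w ->; rewrite atom_count_wtree. Qed.

Lemma count_midx_seq i k : count_mem i (midx_seq k) = k i.
Proof.
rewrite /midx_seq count_flatten -map_comp.
rewrite (eq_map (g := fun j => if j == i then k i else 0%N)); last first.
  by move=> j /=; rewrite count_nseq /=; case: eqP => [->|]; rewrite ?mul1n.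
rewrite sumn_map big_enum /= (bigD1 i)//= eqxx big1 ?addn0// => j /negPf ->//.
Qed.

Lemma seq_fact_midx_seq k : seq_fact (midx_seq k) = mfact k.
Proof.
rewrite seq_factE /mfact (eq_bigr (fun i => (k i)`!)); last first.
  by move=> i _; rewrite count_midx_seq.
rewrite big_uniq ?undup_uniq//= big_mkcond /=; apply: eq_bigr => i _.
rewrite mem_undup; case: ifP => // /negbT/count_memPn.
by rewrite count_midx_seq => ->.
Qed.

Lemma psymE (a : driver d Lm Lp * midx d)
    (r : seq (otype * ptree (driver d Lm Lp * midx d) otype)) :
  psym (PNode a r) =
  (mfact a.2 * (\prod_(x <- r) psym x.2) * seq_fact r)%N.
Proof.
case: a => l k; rewrite seq_factE /=; congr (_ * _ * _)%N.
by elim: r => [|x r IH]; rewrite ?big_nil ?big_cons //= IH.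
Qed.

Lemma tsymE sigma : tsym sigma =
  (mfact (rdec (val sigma)).2 * (\prod_(x <- vkids sigma) tsym x.2) *
   seq_fact (vkids sigma))%N.
Proof.
rewrite /tsym [in LHS](node_eta (val sigma)) psymE -[in LHS]vkids_val.
rewrite big_map seq_fact_map//.
by move=> [q x] [q1 x'] [-> /val_inj ->].
Qed.

Lemma tsym_vnode l k r : tsym (@vnode d Lm Lp l k r) =
  (mfact k * (\prod_(x <- r) tsym x.2) * seq_fact r)%N.
Proof.
have P : perm_eq (vkids (vnode l k r)) r.
  apply: (@perm_map_inj _ _ (fun x : otype * vtree => (x.1, val x.2))).
    by move=> [q x] [q1 x'] [-> /val_inj ->].
  by rewrite vkids_val; exact: kids_vnode.
by rewrite tsymE rdec_vnode (perm_big _ P) (perm_seq_fact P).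
Qed.

Lemma mfact0 : mfact (0 : midx d) = 1%N.
Proof. by rewrite /mfact big1// => i _; rewrite ffunE. Qed.

Lemma tsym_Xpow k : tsym (Xpow Lm Lp k) = mfact k.
Proof. by rewrite tsym_vnode big_nil !muln1. Qed.

Lemma tsym_planted o tau : tsym (planted o tau) = tsym tau.
Proof. by rewrite tsym_vnode big_seq1 mfact0 mul1n muln1. Qed.

Lemma tsym_gt0 sigma : (0 < tsym sigma)%N.
Proof.
rewrite /tsym; elim/ptree_ind_seq: (val sigma) => a r IH.
rewrite psymE !muln_gt0; apply/andP; split; last first.
  by rewrite seq_factE prodn_gt0// => x; exact: fact_gt0.
apply/andP; split; first by apply: prodn_gt0 => i; exact: fact_gt0.
elim: r IH => [|x r IHr] /=; first by rewrite big_nil.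
by move=> [x0 /IHr]; rewrite big_cons muln_gt0 x0.
Qed.

(** Branches come before the X letters because the rule for removing X_i holds on words of X letters
    only. The reversal compensates for that in [taylor_sum_dXs], where the first letter gives the
    innermost derivative. *)
Definition root_word sigma : seq atom :=
  map inr (vkids sigma) ++ map inl (rev (midx_seq (rdec (val sigma)).2)).

(** The root part of the symmetry factor is exactly the weight in [wcoef]; the remainder is
    distributed over the branches. *)
Lemma tsym_word_fact sigma :
  tsym sigma = (word_fact (root_word sigma) * \prod_(x <- vkids sigma) tsym x.2)%N.
Proof.
rewrite tsymE word_factE seq_fact_cat_sum -seq_fact_midx_seq mulnAC.
rewrite (@perm_seq_fact _ (rev _) (midx_seq (rdec (val sigma)).2)) ?perm_rev//.
by rewrite (mulnC (seq_fact _)).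
Qed.

Lemma count_vkids (z : otype * vtree) x : count_mem z (vkids x) = atom_count (inr z) x.
Proof.
case: z => q tau; rewrite /atom_count -vkids_val [RHS]count_map; apply: eq_count => -[q1 t] /=.
by rewrite !xpair_eqE (inj_eq val_inj).
Qed.

Lemma nodriver_vnode k r : nodriver (vnode (driver0 d Lm Lp) k r).
Proof. exact: eqxx. Qed.

Lemma tree_atom_count_eq x y : nodriver x -> nodriver y ->
  (forall a, atom_count a x = atom_count a y) -> x = y.
Proof.
move=> nx ny xy; apply: tree_eq.
  rewrite [LHS]surjective_pairing [RHS]surjective_pairing (nodriverP nx) (nodriverP ny).
  by congr (_, _); apply/ffunP => i; exact: (xy (inl i)).
rewrite -!vkids_val perm_map//; apply/allP => z _ /=; apply/eqP.
by rewrite !count_vkids.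
Qed.


Lemma count_root_word a sigma : count_mem a (root_word sigma) = atom_count a sigma.
Proof.
rewrite count_cat count_map_inl count_map_inr; case: a => [i|z].
  by rewrite add0n count_rev count_midx_seq.
by rewrite addn0 count_vkids.
Qed.

Lemma wtree_root_word sigma : wtree (root_word sigma) =
  vnode (driver0 d Lm Lp) (rdec (val sigma)).2 (vkids sigma).
Proof.
apply: tree_atom_count_eq => [||a]; first exact: nodriver_wtree.
  exact: nodriver_vnode.
rewrite atom_count_wtree count_root_word; case: a => [i|[q tau]].
  by rewrite /atom_count rdec_vnode.
rewrite /atom_count (permP (kids_vnode _ _ _)); congr (count_mem _ _).
by rewrite vkids_val.
Qed.

End Trees.

(** * Taylor expansion along a jet *)

Section JetWords.
Variables (R : realType) (d : nat) (Lm Lp : finType).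
Local Notation otype := (otype d Lp).
Local Notation vtree := (vtree d Lm Lp).
Local Notation fseries := (fseries R d Lm Lp).
Local Notation atom := ('I_d.+1 + otype * vtree)%type.
Local Notation tone := (tone d Lm Lp).
Variable U : jet R d Lm Lp.
Implicit Types (sigma tau : vtree) (o : otype) (f : fseries) (k m : midx d).
Implicit Types (a : atom) (w : seq atom) (r : seq 'I_d.+1).

Lemma fsum_deltat (P : set vtree) f sigma : 
  \sum_(tau \in P) f tau * deltat R tau sigma = if sigma \in P then f sigma else 0.
Proof.
have [Ps|nPs] := boolP (sigma \in P); last first.
  rewrite fsbig1// => tau Pt; rewrite /deltat; case: eqP => [E|]; last by rewrite mulr0.
  by move: nPs; rewrite E mem_set.
rewrite -(@fsbig_widen _ _ _ _ [set sigma]).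
- by rewrite fsbig_set1 /deltat eqxx mulr1.
- by move=> _ ->; exact: set_mem.
- move=> tau [_ ne] /=; rewrite /deltat; case: eqP => [E|]; last by rewrite mulr0.
  by case: ne.
Qed.

Lemma tinner_deltar f tau : tinner f (deltat R tau) = f tau * (tsym tau)%:R.
Proof.
rewrite /tinner (eq_fsbigr (fun sigma => f sigma * (tsym sigma)%:R * deltat R sigma tau)).
  by rewrite fsum_deltat in_setT.
by move=> sigma _; rewrite /deltat mulrAC eq_sym.
Qed.

Lemma tinner_deltal f tau : tinner (deltat R tau) f = f tau * (tsym tau)%:R.
Proof.
rewrite -tinner_deltar; apply: eq_fsbigr => sigma _.
by rewrite [_ * f _]mulrC.
Qed.

Lemma jetuE o : jetu U o = U o.1 (Xpow Lm Lp o.2) * (mfact o.2)%:R.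
Proof. by rewrite /jetu tinner_deltal tsym_Xpow. Qed.

Lemma Xpow_inj : injective (@Xpow d Lm Lp).
Proof. by move=> k m E; have := congr1 (fun x => (rdec (val x)).2) E. Qed.

Lemma Xpow_planted k o tau : Xpow Lm Lp k <> planted o tau.
Proof.
move=> E; have := congr1 (fun x => kids (val x)) E.
by rewrite kids_vnode0 kids_planted.
Qed.

Lemma mle_add o m : mle o.2 (o.2 + m).
Proof. by apply/forallP => i; rewrite ffunE leq_addr. Qed.

Lemma msub_add k m : msub (k + m) k = m.
Proof. by apply/ffunP => i; rewrite !ffunE; exact: addKn. Qed.

Lemma add_msub k m : mle k m -> k + msub m k = m.
Proof. by move=> /forallP km; apply/ffunP => i; rewrite !ffunE; exact: subnKC. Qed.

Lemma mfact_neq0 k : (mfact k)%:R != 0 :> R.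
Proof.
by rewrite pnatr_eq0 -lt0n prodn_gt0// => i; exact: fact_gt0.
Qed.

Lemma jetD_other o sigma : (forall k, sigma <> Xpow Lm Lp k) ->
  (forall tau, sigma <> planted o tau) -> jetD U o sigma = 0.
Proof.
move=> nX np; rewrite /jetD !fsbig1 ?addr0//.
  by move=> tau _; rewrite /deltat; case: eqP => [/np//|]; rewrite mulr0.
by move=> k _; rewrite /deltat; case: eqP => [/nX//|]; rewrite mulr0.
Qed.

Lemma jetD_Xpow o m : jetD U o (Xpow Lm Lp m) =
  jetu U (o.1, o.2 + m) / (mfact m)%:R.
Proof.
rewrite /jetD [X in _ + X]fsbig1 ?addr0; last first.
  by move=> tau _; rewrite /deltat; case: eqP => [/Xpow_planted//|]; rewrite mulr0.
rewrite -(@fsbig_widen _ _ _ _ [set o.2 + m]).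
- by rewrite fsbig_set1 msub_add /deltat eqxx mulr1 mulrA jetuE.
- by move=> _ ->; exact: mle_add.
- move=> k [/= ok ne]; rewrite /deltat; case: eqP => [/Xpow_inj mE|]; last by rewrite mulr0.
  by case: ne; rewrite mE add_msub.
Qed.

Lemma jetD_planted o q tau : jetD U o (planted q tau) =
  (q == o)%:R * U o.1 (planted (o.1, 0) tau).
Proof.
rewrite /jetD fsbig1 ?add0r; last first.
  by move=> k _; rewrite /deltat; case: eqP => [/esym/Xpow_planted//|]; rewrite mulr0.
have [->|qo] := eqVneq q o.
  rewrite (eq_fsbigr (fun sigma => U o.1 (planted (o.1, 0) sigma) * deltat R sigma tau)).
    by rewrite fsum_deltat in_setT mul1r.
  by move=> sigma _; rewrite /deltat (inj_eq (@planted_inj _ _ _ o)).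
rewrite mul0r fsbig1// => sigma _; rewrite /deltat; case: eqP => [E|]; last by rewrite mulr0.
have := congr1 (@vkids _ _ _) E; rewrite !vkids_planted => -[qE].
by rewrite qE eqxx in qo.
Qed.

Definition jet_incr o : fseries :=
  fun tau => jetD U o tau - jetu U o * deltat R tone tau.

Definition jet_coef o : seq atom -> R := wcoef (jet_incr o).

Lemma jet_incr_supp o : nodriver_supp (jet_incr o).
Proof.
move=> sigma ns; rewrite /jet_incr deltat_tone_supp// mulr0 subr0.
apply: jetD_other => [k E|tau E]; move: ns; rewrite E => /negP; apply.
  exact: nodriver_vnode.
exact: nodriver_vnode.
Qed.

Definition midx_of_seq r : midx d := foldr (fun i => +%R (munit i)) 0 r.

Lemma wtree_inl r : wtree (map inl r) = Xpow Lm Lp (midx_of_seq r).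
Proof.
apply: tree_atom_count_eq => [||a]; [exact: nodriver_wtree|exact: nodriver_vnode|].
rewrite atom_count_wtree count_map_inl; case: a => [i|[q tau]]; last first.
  by rewrite /atom_count kids_vnode0.
rewrite /atom_count rdec_vnode /=; elim: r => [|j r IH]; first by rewrite ffunE.
by rewrite /= !ffunE IH eq_sym.
Qed.

Lemma word_fact_inl r : word_fact (map inl r : seq atom) = mfact (midx_of_seq r).
Proof.
rewrite word_factE seq_fact_map; last by move=> ? ? [].
rewrite -seq_fact_midx_seq; apply: perm_seq_fact; apply/allP => i _ /=.
rewrite count_midx_seq; apply/eqP.
by elim: r => [|j r IH]; rewrite /= !ffunE// IH eq_sym.
Qed.

(** The weight m! of a word of X letters cancels the 1/m! in the jet, which leaves the shifted
    coordinate itself. *)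
Lemma jet_coef_inl o r : jet_coef o (map inl r) =
  jetu U (o.1, o.2 + midx_of_seq r) - jetu U o * (r == [::])%:R.
Proof.
rewrite /jet_coef /wcoef wtree_inl word_fact_inl /jet_incr mulrBr jetD_Xpow.
rewrite mulrC divfK ?mfact_neq0//; congr (_ - _).
case: r => [|i r].
  by rewrite /= /deltat eqxx mfact0 !mulr1 mul1r.
rewrite mulr0 /deltat; case: eqP => [/Xpow_inj/ffunP/(_ i)|]; last by rewrite !mulr0.
by rewrite /= !ffunE eqxx.
Qed.

Lemma jet_coef_nil o : jet_coef o [::] = 0.
Proof. by rewrite (jet_coef_inl o [::]) /= addr0 mulr1 -surjective_pairing subrr. Qed.

(** Increments contain only polynomials and planted trees, so nothing may be left once a branch is
    removed; hence the factor [shuf1]. *)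
Lemma jet_coef_inr o q tau w : jet_coef o (inr (q, tau) :: w) =
  (q == o)%:R * U o.1 (planted (o.1, 0) tau) * shuf1 R w.
Proof.
have ncons : wtree (inr (q, tau) :: w) <> tone.
  move=> E; have := atom_count_wtree (inr (q, tau)) (inr (q, tau) :: w).
  by rewrite E atom_count_tone /= eqxx.
rewrite /jet_coef /wcoef /jet_incr.
rewrite [deltat _ _ _](_ : _ = 0) ?mulr0 ?subr0; last by rewrite /deltat; case: eqP.
case: w ncons => [|b w] ncons.
  rewrite [wtree _](_ : _ = planted q tau); last by rewrite [LHS]tjoinC tone_tjoin.
  by rewrite word_factE jetD_planted /shuf1 eqxx mulr1 mul1r.
rewrite /shuf1 mulr0 jetD_other ?mulr0//.
  move=> k E; have := atom_count_wtree (inr (q, tau)) [:: inr (q, tau), b & w].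
  by rewrite E /atom_count kids_vnode0 /= eqxx.
(* A planted tree consists of one letter of multiplicity one, while this word has at least two
   letters. *)
move=> tau1 E; have cE c := atom_count_wtree c [:: inr (q, tau), b & w].
have pl c : atom_count c (planted o tau1) = (c == inr (o, tau1)).
  exact: (atom_count_atree c (inr (o, tau1))).
have := cE (inr (q, tau)); rewrite E pl /= eqxx.
case: eqP => // -> /=.
have := cE b; rewrite E pl /= eqxx.
by case: eqP => [->|_] //=; case: eqP.
Qed.

#[local] Opaque jet_coef.

Section Recursion.
Variable A : {fset otype}.
Let u := jetu U.
Local Notation fn := (fn R d Lp).
Implicit Types (G H : fn) (n : nat).

(* [taylor_term n G / n!] is the part of degree [n] in the increments of the Taylor
   series of [G] composed with the jet. *)
Fixpoint taylor_term n G : seq atom -> R :=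
  if n is n'.+1 then fun w => \sum_(o <- A) shuf (jet_coef o) (taylor_term n' (pderiv o G)) w
  else fun w => G u * shuf1 R w.

Arguments taylor_term : simpl never.

Lemma taylor_term0 G w : taylor_term 0 G w = G u * shuf1 R w.
Proof. by []. Qed.

Lemma taylor_termS n G : taylor_term n.+1 G =
  fun w => \sum_(o <- A) shuf (jet_coef o) (taylor_term n (pderiv o G)) w.
Proof. by []. Qed.

Lemma taylor_term_zero n : taylor_term n (fun=> 0) = fun=> 0.
Proof.
elim: n => [|n IH]; apply/funext => w; first by rewrite taylor_term0 mul0r.
rewrite taylor_termS big1// => o _.
rewrite (_ : pderiv o _ = fun=> 0); last exact: (@pderivs_0 _ _ _ [:: o]).
by rewrite IH shuf0r.
Qed.

Lemma taylor_term_small n G w : (size w < n)%N -> taylor_term n G w = 0.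
Proof.
elim: n G w => [|n IH] G w wn; first by [].
rewrite taylor_termS big1// => o _; apply: (shuf_eq0S (n := n)) => //.
  exact: jet_coef_nil.
by move=> v; exact: IH.
Qed.

Lemma taylor_term_add n G H w : CO G -> CO H ->
  taylor_term n (fun x => G x + H x) w = taylor_term n G w + taylor_term n H w.
Proof.
elim: n G H w => [|n IH] G H w cG cH; first by rewrite !taylor_term0 mulrDl.
rewrite !taylor_termS -big_split/=; apply: eq_bigr => o _.
rewrite (pderiv_add _ cG cH) -shufDr; congr (shuf _ _ _).
by apply/funext => v; rewrite (IH _ _ _ (CO_pderiv o cG) (CO_pderiv o cH)).
Qed.

Lemma taylor_term_scale n (c : R) G w : CO G ->
  taylor_term n (fun x => c * G x) w = c * taylor_term n G w.
Proof.
elim: n G w => [|n IH] G w cG; first by rewrite !taylor_term0 mulrA.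
rewrite !taylor_termS big_distrr/=; apply: eq_bigr => o _.
rewrite (pderiv_scale _ _ cG) -shufZr; congr (shuf _ _ _).
by apply/funext => v; rewrite (IH _ _ (CO_pderiv o cG)).
Qed.

Lemma taylor_term_sum n (I : eqType) (l : seq I) (G : I -> fn) w :
  (forall i, i \in l -> CO (G i)) ->
  taylor_term n (fun x => \sum_(i <- l) G i x) w = \sum_(i <- l) taylor_term n (G i) w.
Proof.
elim: l => [|i l IH] cG.
  rewrite big_nil (_ : (fun x => _) = fun=> 0) ?taylor_term_zero//.
  by apply/funext => x; rewrite big_nil.
have cl j : j \in l -> CO (G j) by move=> jl; apply: cG; rewrite inE jl orbT.
rewrite big_cons -IH// -taylor_term_add.
- by congr (taylor_term _ _ _); apply/funext => x; rewrite big_cons.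
- by apply: cG; rewrite mem_head.
- exact: CO_sum_seq.
Qed.

(** A derivation hits any of the n increments, and these are interchangeable. In the induction the
    outermost one accounts for one copy and the inner ones for the rest, once [pderivC] and [shufCA]
    have moved the factor that is hit to the front. *)
Lemma taylor_term_cons n G a w : CO G -> taylor_term n G (a :: w) =
  n%:R * \sum_(o <- A) shuf (fun v => jet_coef o (a :: v)) (taylor_term n.-1 (pderiv o G)) w.
Proof.
elim: n G w => [|n IH] G w cG; first by rewrite taylor_term0 /shuf1 mulr0 mul0r.
rewrite taylor_termS; under eq_bigr do rewrite shuf_cons.
rewrite big_split /= -[in RHS]addn1 natrD mulrDl mul1r addrC; congr (_ + _).
case: n IH => [|n] IH.
  rewrite mul0r big1// => o _.
  rewrite (_ : (fun v => _) = fun=> 0) ?shuf0r//.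
  by apply/funext => v; rewrite taylor_term0 /shuf1 mulr0.
transitivity (\sum_(o <- A) n.+1%:R * \sum_(q <- A)
    shuf (fun v => jet_coef q (a :: v))
      (shuf (jet_coef o) (taylor_term n (pderiv o (pderiv q G)))) w).
  apply: eq_bigr => o _; rewrite big_distrr /=.
  transitivity (shuf (jet_coef o) (fun v => \sum_(q <- A) (n.+1%:R *
     shuf (fun v => jet_coef q (a :: v)) (taylor_term n (pderiv o (pderiv q G))) v)) w).
    congr (shuf _ _ _); apply/funext => v; rewrite (IH _ _ (CO_pderiv o cG)).
    rewrite big_distrr /=; apply: eq_bigr => q _.
    by rewrite (pderivC q o cG).
  rewrite shuf_sumr; apply: eq_bigr => q _.
  by rewrite shufZr shufCA.
rewrite -big_distrr /=; congr (_ * _).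
rewrite exchange_big /=; apply: eq_bigr => q _.
by rewrite taylor_termS shuf_sumr.
Qed.

Lemma taylor_term_inr n G q tau w : CO G -> depends_on [set` A] G ->
  taylor_term n G (inr (q, tau) :: w) =
  n%:R * U q.1 (planted (q.1, 0) tau) * taylor_term n.-1 (pderiv q G) w.
Proof.
move=> cG GA; rewrite (taylor_term_cons _ _ _ cG) -mulrA; congr (_ * _).
have E o : shuf (fun v => jet_coef o (inr (q, tau) :: v)) (taylor_term n.-1 (pderiv o G)) w =
    (q == o)%:R * U o.1 (planted (o.1, 0) tau) * taylor_term n.-1 (pderiv o G) w.
  rewrite (_ : (fun v => _) = fun v =>
    (q == o)%:R * U o.1 (planted (o.1, 0) tau) * shuf1 R v).
    by rewrite shufZl shuf1l.
  by apply/funext => v; rewrite jet_coef_inr.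
under eq_bigr do rewrite E.
have [qA|qA] := boolP (q \in A).
  rewrite (bigD1_seq q) ?fset_uniq//= eqxx mul1r big1 ?addr0//.
  by move=> o; rewrite eq_sym => /negPf ->; rewrite !mul0r.
rewrite (pderiv_notin GA) ?taylor_term_zero ?mulr0; last exact/negP.
rewrite big_seq big1// => o oA; case: eqP => [qo|_]; last by rewrite !mul0r.
by rewrite qo oA in qA.
Qed.

(** Multiplicativity of Taylor series when one factor is a coordinate, whose series is [u q] plus
    one increment. The factor [n] comes from the normalisation by n!, and at [n = 0] it absorbs the
    default value of [n.-1]. *)
Lemma taylor_term_coordM n q G w : CO G -> q \in A ->
  taylor_term n (fun x => x q * G x) w =
  u q * taylor_term n G w + n%:R * shuf (jet_coef q) (taylor_term n.-1 G) w.
Proof.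
move=> + qA; elim: n G w => [|n IH] G w cG.
  by rewrite !taylor_term0 mul0r addr0 mulrA.
rewrite taylor_termS.
transitivity (\sum_(o <- A) (u q * shuf (jet_coef o) (taylor_term n (pderiv o G)) w +
   n%:R * shuf (jet_coef o) (shuf (jet_coef q) (taylor_term n.-1 (pderiv o G))) w +
   (q == o)%:R * shuf (jet_coef o) (taylor_term n G) w)).
  apply: eq_bigr => o _; rewrite -!shufZr -!shufDr; congr (shuf _ _ _).
  apply/funext => v; rewrite (pderiv_coordM _ _ cG) taylor_term_add.
  - by rewrite (IH _ _ (CO_pderiv o cG)) (taylor_term_scale _ _ _ cG).
  - by apply: CO_coordM; exact: CO_pderiv.
  - exact: CO_scale.
have S : \sum_(o <- A) (q == o)%:R * shuf (jet_coef o) (taylor_term n G) w =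
    shuf (jet_coef q) (taylor_term n G) w.
  rewrite (bigD1_seq q) ?fset_uniq//= eqxx mul1r big1 ?addr0// => o.
  by rewrite eq_sym => /negPf ->; rewrite mul0r.
rewrite !big_split /= -!big_distrr /= S -addrA; congr (_ + _).
rewrite -natr1 mulrDl mul1r; congr (_ + _).
case: n {IH S} => [|n]; first by rewrite !mul0r.
congr (_ * _); rewrite taylor_termS shuf_sumr; apply: eq_bigr => o _.
exact: shufCA.
Qed.

Definition taylor_sum N G w : R := \sum_(n < N) taylor_term n G w / (n`!)%:R.

Lemma factS_inv n : n.+1%:R / (n.+1`!)%:R = (n`!)%:R^-1 :> R.
Proof. by rewrite factS natrM invfM mulrA divff ?mul1r// pnatr_eq0. Qed.

Lemma taylor_sum_cons N G a w : CO G -> taylor_sum N.+1 G (a :: w) =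
  \sum_(n < N) (\sum_(o <- A)
    shuf (fun v => jet_coef o (a :: v)) (taylor_term n (pderiv o G)) w)
    / (n`!)%:R.
Proof.
move=> cG; rewrite /taylor_sum big_ord_recl taylor_term0 /shuf1 mulr0 mul0r add0r.
apply: eq_bigr => n _; rewrite lift0 (taylor_term_cons _ _ _ cG).
by rewrite mulrAC factS_inv mulrC.
Qed.

Lemma taylor_sum_inr N G q tau w : CO G -> depends_on [set` A] G ->
  taylor_sum N.+1 G (inr (q, tau) :: w) =
  U q.1 (planted (q.1, 0) tau) * taylor_sum N (pderiv q G) w.
Proof.
move=> cG GA; rewrite /taylor_sum big_ord_recl taylor_term0 /shuf1 mulr0 mul0r add0r.
rewrite big_distrr; apply: eq_bigr => n _; rewrite lift0 (taylor_term_inr _ _ _ _ cG GA).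
by rewrite -[X in X / _]mulrA mulrAC factS_inv [LHS]mulrC -mulrA.
Qed.

Lemma taylor_sum_nil N G : taylor_sum N.+1 G [::] = G u.
Proof.
rewrite /taylor_sum big_ord_recl taylor_term0 mulr1 divr1 big1 ?addr0// => n _.
by rewrite taylor_term_small// mul0r.
Qed.

End Recursion.

(** A finite bound for the coordinates of [dX i G] when [G] depends on [B], uniform in [i]. *)
Definition grow (B : {fset otype}) : {fset otype} :=
  (B `|` [fset z in [seq ((o.1, (o.2 + munit i)%R) : otype) | o <- enum_fset B,
                                                          i <- enum 'I_d.+1]])%fset.

Lemma growP (B : {fset otype}) o i : o \in B -> (o.1, o.2 + munit i) \in grow B.
Proof.
move=> oB; rewrite in_fsetU; apply/orP; right; rewrite !inE.
by apply/allpairsP; exists (o, i); rewrite /= mem_enum.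
Qed.

Lemma grow_sub (B : {fset otype}) : (B `<=` grow B)%fset.
Proof. exact: fsubsetUl. Qed.

Lemma iter_grow_sub n (B : {fset otype}) : (B `<=` iter n grow B)%fset.
Proof.
elim: n => [|n IH]; first exact: fsubset_refl.
exact: fsubset_trans IH (grow_sub _).
Qed.

Lemma depends_dX (B : {fset otype}) i (G : fn R d Lp) : depends_on [set` B] G ->
  depends_on [set` grow B] (dX i G).
Proof.
move=> GB x y xy; rewrite (dXE i GB); apply: eq_big_seq => o oB.
rewrite xy; last exact: growP.
congr (_ * _); apply: (depends_pderiv o GB) => q /= qB.
by apply: xy; rewrite /= (fsubsetP (grow_sub B)).
Qed.

Lemma jet_coef_cons_inl o i r : jet_coef o (inl i :: map inl r) =
  jet_coef (o.1, o.2 + munit i) (map inl r) +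
  jetu U (o.1, o.2 + munit i) * shuf1 R (map inl r : seq atom).
Proof.
have E : jet_coef o (inl i :: map inl r) = jetu U (o.1, o.2 + midx_of_seq (i :: r)).
  have := jet_coef_inl o (i :: r); have -> : (i :: r == [::]) = false by [].
  by rewrite mulr0 subr0.
have F : jet_coef (o.1, o.2 + munit i) (map inl r) =
    jetu U (o.1, o.2 + midx_of_seq (i :: r)) -
    jetu U (o.1, o.2 + munit i) * shuf1 R (map inl r : seq atom).
  rewrite jet_coef_inl; have -> : shuf1 R (map inl r : seq atom) = (r == [::])%:R by case: (r).
  by rewrite -addrA.
by rewrite E F subrK.
Qed.

(** A shuffle only reads its factors at subwords. So [jet_coef_cons_inl], which concerns words of X
    letters, can be used inside products. *)
Lemma shuf_inl (f f' g : seq atom -> R) r :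
  (forall r', f (map inl r') = f' (map inl r')) ->
  shuf f g (map inl r) = shuf f' g (map inl r).
Proof.
elim: r f f' g => [|i r IH] f f' g ff'; first by rewrite /shuf /= (ff' [::]).
rewrite [map _ _]/= !shuf_cons (IH _ _ _ ff').
rewrite (IH (fun u => f (inl i :: u)) (fun u => f' (inl i :: u)))// => r'.
exact: (ff' (i :: r')).
Qed.

(** In [dX i G] each derivative [pderiv o G] is multiplied by the coordinate shifted by e_i, and
    [taylor_term_coordM] expands this into the constant and the increment of that coordinate.
    Removing X_i from the increment of [o] produces the same two parts. *)
Lemma taylor_sum_inl (A B : {fset otype}) N (G : fn R d Lp) i r : CO G ->
  depends_on [set` B] G -> (grow B `<=` A)%fset -> (size r < N)%N ->
  taylor_sum A N.+1 G (map inl (i :: r)) = taylor_sum A N (dX i G) (map inl r).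
Proof.
move=> cG GB BA rN; rewrite taylor_sum_cons//.
pose q o : otype := (o.1, o.2 + munit i).
have sA o : o \in B -> q o \in A by move=> oB; apply: (fsubsetP BA); exact: growP.
have E n : \sum_(o <- A)
     shuf (fun v => jet_coef o (inl i :: v)) (taylor_term A n (pderiv o G)) (map inl r)
   = \sum_(o <- B) (jetu U (q o) * taylor_term A n (pderiv o G) (map inl r) +
                    shuf (jet_coef (q o)) (taylor_term A n (pderiv o G)) (map inl r)).
  transitivity (\sum_(o <- B)
      shuf (fun v => jet_coef o (inl i :: v)) (taylor_term A n (pderiv o G)) (map inl r)).
    apply/esym/big_fset_incl => [|o oA oB].
      exact: fsubset_trans (grow_sub B) BA.
    by rewrite (pderiv_notin GB) ?taylor_term_zero ?shuf0r//; apply/negP.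
  apply: eq_bigr => o _.
  rewrite (@shuf_inl _ (fun v => jetu U (q o) * shuf1 R v + jet_coef (q o) v)).
    by rewrite shufDl shufZl shuf1l.
  by move=> r'; rewrite jet_coef_cons_inl addrC.
under eq_bigr do rewrite E.
have E' n : taylor_term A n (dX i G) (map inl r) =
   \sum_(o <- B) (jetu U (q o) * taylor_term A n (pderiv o G) (map inl r) +
     n%:R * shuf (jet_coef (q o)) (taylor_term A n.-1 (pderiv o G)) (map inl r)).
  rewrite (dXE i GB) taylor_term_sum; last by move=> o _; exact: CO_dX_term.
  by apply: eq_big_seq => o oB; rewrite (taylor_term_coordM _ _ (CO_pderiv o cG) (sA o oB)).
rewrite /taylor_sum; under [RHS]eq_bigr do rewrite E'.
under eq_bigr do rewrite big_split mulrDl; under [RHS]eq_bigr do rewrite big_split mulrDl.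
rewrite !big_split /=; congr (_ + _).
(* The increment parts agree after a shift of the degree by one: the top degree on the left vanishes
   because the word is too short, and degree 0 on the right carries the factor 0. *)
case: N rN => // N rN; rewrite big_ord_recr big_ord_recl /=.
rewrite [X in _ + X = _](_ : _ = 0); last first.
  rewrite big1 ?mul0r// => o _; apply: (shuf_eq0S (n := N)).
  - exact: jet_coef_nil.
  - by move=> v; exact: taylor_term_small.
  - by rewrite size_map.
rewrite [X in _ = X + _](_ : _ = 0); last by rewrite big1 ?mul0r// => o _; rewrite mul0r.
rewrite addr0 add0r; apply: eq_bigr => n _.
by rewrite -big_distrr /= mulrAC factS_inv mulrC.
Qed.

Lemma taylor_sum_dXs (A B : {fset otype}) N (G : fn R d Lp) r : CO G ->
  depends_on [set` B] G -> (iter (size r) grow B `<=` A)%fset -> (size r < N)%N ->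
  taylor_sum A N G (map inl r) = dXs (rev r) G (jetu U).
Proof.
elim: r B N G => [|i r IH] B [|N] G cG GB BA rN //.
  by rewrite taylor_sum_nil.
have gB : (grow B `<=` A)%fset.
  by apply: fsubset_trans BA; rewrite iterSr; exact: iter_grow_sub.
rewrite (taylor_sum_inl i cG GB gB (rN : (size r < N)%N)) (IH (grow B)).
- by rewrite /dXs rev_cons foldr_rcons.
- exact: CO_dX.
- exact: depends_dX.
- by rewrite -iterSr.
- exact: rN.
Qed.

Lemma taylor_sum_word (A : {fset otype}) N (G : fn R d Lp) (l : seq (otype * vtree)) r B :
  CO G -> depends_on [set` B] G -> (iter (size r) grow B `<=` A)%fset ->
  (size (map inr l ++ map inl r : seq atom) < N)%N ->
  taylor_sum A N G (map inr l ++ map inl r) =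
  (\prod_(x <- l) U x.1.1 (planted (x.1.1, 0) x.2)) *
  dXs (rev r) (pderivs (unzip1 l) G) (jetu U).
Proof.
elim: l G N => [|[q tau] l IH] G [|N] cG GB BA lN //.
  rewrite cat0s size_map in lN.
  by rewrite big_nil mul1r (taylor_sum_dXs cG GB BA lN).
have GA : depends_on [set` A] G.
  apply: depends_sub GB => o /= oB; apply: (fsubsetP BA).
  exact: (fsubsetP (iter_grow_sub _ _)).
rewrite [map _ _ ++ _]/= (taylor_sum_inr _ _ _ _ cG GA).
rewrite (IH _ _ (CO_pderiv q cG) (depends_pderiv q GB) BA lN).
by rewrite (pderivs_pderiv _ _ cG) big_cons mulrA.
Qed.

End JetWords.

(** * Regrouping the sum over multi-indices by degree *)

Section TaylorSum.
Variables (R : realType) (d : nat) (Lm Lp : finType).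
Local Notation otype := (otype d Lp).
Local Notation vtree := (vtree d Lm Lp).
Local Notation fseries := (fseries R d Lm Lp).
Local Notation atom := ('I_d.+1 + otype * vtree)%type.
Local Notation fn := (fn R d Lp).
Variable U : jet R d Lm Lp.
Implicit Types (o : otype) (w : seq atom) (G : fn) (alpha beta : {mset otype}).
Implicit Types (r : seq otype).

Definition jet_coefs r : seq atom -> R := foldr (fun o => shuf (jet_coef U o)) (@shuf1 R _) r.

Lemma jet_coefs_cons o r : jet_coefs (o :: r) = shuf (jet_coef U o) (jet_coefs r).
Proof. by []. Qed.

Lemma jet_coefs_perm r r' : perm_eq r r' -> jet_coefs r = jet_coefs r'.
Proof.
elim: r r' => [|o r IH] r' rr'.
  by move: rr'; rewrite perm_sym => /perm_nilP ->.
have or' : o \in r' by rewrite -(perm_mem rr') mem_head.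
case/splitPr: or' rr' => a b rr'.
have {}rr' : perm_eq r (a ++ b).
  by rewrite -(perm_cons o) (perm_trans rr')// (perm_catCA a [:: o]).
rewrite jet_coefs_cons (IH _ rr'); elim: a {IH rr'} => [|q a IHa]; first by [].
by apply/funext => w; rewrite !cat_cons !jet_coefs_cons -IHa shufCA.
Qed.

Lemma jet_coefs_small r w : (size w < size r)%N -> jet_coefs r w = 0.
Proof.
elim: r w => [|o r IH] w // wr; rewrite jet_coefs_cons.
by apply: (shuf_eq0S (n := size r)) => //; exact: jet_coef_nil.
Qed.

Lemma jets_supp r f : List.In f [seq jet_incr U o | o <- r] -> nodriver_supp f.
Proof. by elim: r => //= o r IH [<-|/IH//]; exact: jet_incr_supp. Qed.

Lemma wcoef_jets r : wcoef (sprod [seq jet_incr U o | o <- r]) = jet_coefs r.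
Proof.
rewrite wcoef_sprod; last by move=> f; exact: jets_supp.
by elim: r => //= o r ->.
Qed.

Lemma multifactE alpha : multifact alpha = seq_fact alpha.
Proof.
rewrite seq_factE /multifact -(perm_big _ (perm_undup_mset alpha)).
by apply: eq_bigr => o _; rewrite count_mem_mset.
Qed.

Lemma perm_mset_cons o beta : perm_eq (o +` beta) (o :: beta).
Proof.
apply/allP => q _ /=; by apply/eqP; rewrite !count_mem_mset mset1DE eq_sym.
Qed.

Lemma multifact_cons o beta :
  multifact (o +` beta) = ((beta o).+1 * multifact beta)%N.
Proof.
by rewrite !multifactE (perm_seq_fact (perm_mset_cons o beta)) /= count_mem_mset.
Qed.

Lemma multifact_neq0 alpha : (multifact alpha)%:R != 0 :> R.
Proof.
by rewrite pnatr_eq0 -lt0n prodn_gt0// => i; exact: fact_gt0.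
Qed.

Section Degrees.
Variable A : {fset otype}.

Definition msets n : set {mset otype} :=
  [set alpha | size alpha = n /\ {subset alpha <= A}].

Lemma msets_cons n o beta : o \in A -> msets n beta -> msets n.+1 (o +` beta).
Proof.
move=> oA [<- bA]; split; first by rewrite (perm_size (perm_mset_cons o beta)).
move=> q; rewrite (perm_mem (perm_mset_cons o beta)) inE => /orP[/eqP->//|].
exact: bA.
Qed.

Lemma msets_uncons n o alpha : msets n.+1 alpha -> o \in alpha ->
  exists2 beta, msets n beta & alpha = o +` beta.
Proof.
move=> [sa aA] oa; exists (alpha `\ o); last by rewrite msetB1K.
have aE : alpha = o +` (alpha `\ o) by rewrite msetB1K.
split.
  by move: sa; rewrite {1}aE (perm_size (perm_mset_cons _ _)) => -[].
move=> q qa; apply: aA; rewrite aE (perm_mem (perm_mset_cons _ _)) inE.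
by apply/orP; right.
Qed.

Lemma msets0 : msets 0 = [set mset0].
Proof.
apply/seteqP; split => [alpha [/size0nil a0 _]|_ ->].
  by apply/msetP => o; rewrite -count_mem_mset a0 mset0E.
by split; [rewrite enum_mset0|move=> q; rewrite in_mset0].
Qed.

Lemma finite_msets n : finite_set (msets n).
Proof.
elim: n => [|n IH]; first by rewrite msets0; exact: finite_set1.
apply: (@sub_finite_set _ _ ((fun x : otype * {mset otype} => x.1 +` x.2) @`
   ([set` A] `*` msets n)%classic)); last first.
  by apply: finite_image; apply: finite_setX => //; exact: finite_fset.
move=> alpha aM; case aE : (enum_mset alpha) (aM) => [|o r] [sa aA].
  by rewrite aE in sa.
have oa : o \in enum_mset alpha by rewrite aE mem_head.
have [beta bM abE] := msets_uncons aM oa.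
by exists (o, beta) => //; split => //=; exact: aA.
Qed.

Definition taylor_coef G w alpha : R :=
  Dmulti alpha G (jetu U) / (multifact alpha)%:R * jet_coefs alpha w.

(** A multinomial count. A multiset alpha of size n+1 arises from some beta by adding [o], for each
    [o] in alpha; then 1/beta! is alpha(o)/alpha!, and the numbers alpha(o) add up to n+1. *)
Lemma taylor_degree n G w : CO G ->
  taylor_term U A n G w = (n`!)%:R * \sum_(alpha \in msets n) taylor_coef G w alpha.
Proof.
elim: n G w => [|n IH] G w cG.
  rewrite msets0 fsbig_set1 /taylor_coef /Dmulti /multifact.
  rewrite taylor_term0 enum_mset0 finsupp0 big_seq_fset0 divr1 mul1r//.
rewrite taylor_termS.
pose c alpha := Dmulti alpha G (jetu U) * jet_coefs alpha w.
transitivity (\sum_(o <- A) (n`!)%:R * \sum_(alpha \in msets n.+1)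
    ((alpha o)%:R / (multifact alpha)%:R * c alpha)).
  apply: eq_big_seq => o oA.
  rewrite (_ : taylor_term U A n (pderiv o G) = fun v => (n`!)%:R *
     \sum_(beta <- fset_set (msets n)) taylor_coef (pderiv o G) v beta); last first.
    apply/funext => v; rewrite (IH _ _ (CO_pderiv o cG)).
    by rewrite (fsbig_finite _ _ (finite_msets n)).
  rewrite shufZr shuf_sumr; congr (_ * _).
  rewrite -(fsbig_finite _ _ (finite_msets n)).
  pose h alpha := (alpha o)%:R / (multifact alpha)%:R * c alpha : R.
  have E beta :
      shuf (jet_coef U o) (fun v => taylor_coef (pderiv o G) v beta) w = h (o +` beta).
    rewrite /taylor_coef shufZr -jet_coefs_cons /h /c mset1DE eqxx add1n multifact_cons.
    rewrite (jet_coefs_perm (perm_mset_cons o beta)) /Dmulti.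
    rewrite (pderivs_perm cG (perm_mset_cons o beta)) -(pderivs_pderiv _ _ cG).
    rewrite natrM; field.
    by rewrite multifact_neq0 nat1r pnatr_eq0.
  transitivity (\sum_(beta \in msets n) h (o +` beta)).
    by apply: eq_fsbigr => beta _; exact: E.
  rewrite -(@fsbig_image _ _ _ _ _ (msets n) (fun beta => o +` beta) h); last first.
    move=> b b' _ _ bb'; have := congr1 (msetB^~ [mset o]) bb'.
    by rewrite !msetDKB.
  apply: fsbig_widen => [_ [beta bM <-]|alpha [aM nb]]; first exact: msets_cons.
  (* Multisets that do not arise by adding [o] have multiplicity 0 at [o], hence weight 0. *)
  rewrite /= /h; have [oa|oa] := boolP (o \in enum_mset alpha).
    by have [beta bM bE] := msets_uncons aM oa; case: nb; exists beta.
  by rewrite -count_mem_mset (count_memPn oa) !mul0r.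
rewrite -big_distrr /= factS mulnC natrM -mulrA; congr (_ * _).
rewrite (fsbig_finite _ _ (finite_msets n.+1)).
under eq_bigr do rewrite (fsbig_finite _ _ (finite_msets n.+1)).
rewrite exchange_big /= big_distrr /=; apply: eq_big_seq => alpha.
rewrite in_fset_set ?inE; last exact: finite_msets.
move=> [sa aA]; rewrite -!big_distrl /=.
rewrite -natr_sum (_ : (\sum_(o <- A) alpha o)%N = n.+1).
  by rewrite /taylor_coef /c; ring.
rewrite -sa -[RHS]sum1_size [RHS]sum_mset; under [RHS]eq_bigr do rewrite muln1.
apply/esym/big_fset_incl => [|o _ oa]; last exact: fsfun_dflt.
by apply/fsubsetP => o; rewrite msuppE => /aA.
Qed.

(** The other multisets contribute nothing: one of size at least [N] has more increments than the
    word has letters, and one that leaves [A] differentiates [G] in a coordinate on which it does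
    not depend. *)
Lemma taylor_sum_taylor N G w : CO G -> depends_on [set` A] G -> (size w < N)%N ->
  taylor_sum U A N G w = \sum_(alpha \in [set: {mset otype}]) taylor_coef G w alpha.
Proof.
move=> cG GA wN.
pose S N : set {mset otype} := [set alpha | (size alpha < N)%N /\ {subset alpha <= A}].
have SS M : S M.+1 = (S M `|` msets M)%classic.
  apply/seteqP; split=> alpha.
    by move=> [/= + aA]; rewrite ltnS leq_eqVlt => /orP[/eqP aM|aM]; [right|left].
  by move=> [[/= aM aA]|[/= aM aA]]; split => //=; rewrite ?aM// ltnS ltnW.
have S0 : S 0%N = set0 by apply/seteqP; split => // alpha [].
have finS M : finite_set (S M).
  elim: M => [|M IH]; first by rewrite S0; exact: finite_set0.
  by rewrite SS finite_setU; split => //; exact: finite_msets.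
transitivity (\sum_(alpha \in S N) taylor_coef G w alpha).
  rewrite /taylor_sum; elim: N {wN} => [|M IH]; first by rewrite big_ord0 S0 fsbig_set0.
  rewrite big_ord_recr IH SS fsbigU0/=; first last.
  - by move=> alpha [[/= + _] [/= aM _]]; rewrite aM ltnn.
  - exact: finite_msets.
  - exact: finS.
  congr (_ + _); rewrite (taylor_degree _ _ cG) mulrAC divff ?mul1r//.
suff H alpha : ~ S N alpha -> taylor_coef G w alpha = 0.
  by apply: fsbig_widen => // alpha [_ /H].
move=> nS; rewrite /taylor_coef.
have [aN|aN] := ltnP (size alpha) N; last first.
  by rewrite jet_coefs_small ?mulr0// (leq_trans wN).
have /allPn[q oa oA] : ~~ all (fun z => z \in A) alpha.
  by apply/negP => /allP aA; apply: nS.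
rewrite /Dmulti (pderivs_perm cG (perm_to_rem oa)) -(pderivs_pderiv _ _ cG).
rewrite (pderiv_notin GA); last exact/negP.
by rewrite pderivs_0 !mul0r.
Qed.

End Degrees.

Lemma wcoef_nonlin_at F t l (A : {fset otype}) N w : CO (F t l) ->
  depends_on [set` A] (F t l) -> (size w < N)%N ->
  wcoef (@nonlin_at R d Lm Lp F U t l) w = taylor_sum U A N (F t l) w.
Proof.
move=> cG GA wN; rewrite (taylor_sum_taylor cG GA wN) /wcoef /nonlin_at mulr_fsumr.
apply: eq_fsbigr => alpha _; rewrite mulrCA /taylor_coef.
by rewrite -wcoef_jets.
Qed.

Lemma nonlin_at_supp F t l : nodriver_supp (@nonlin_at R d Lm Lp F U t l).
Proof.
move=> sigma ns; rewrite /nonlin_at fsbig1// => alpha _.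
by rewrite (sprod_supp (@jets_supp (enum_mset alpha))) ?mulr0.
Qed.

End TaylorSum.

(** * Coherence *)

Section Coherence.
Variables (R : realType) (d : nat) (s : 'I_d.+1 -> R).
Variables (Lm Lp : finType) (hom : label Lm Lp -> R).
Variable reg : option (label Lm Lp) -> R.
Variable rule : label Lm Lp -> set {mset etype d Lm Lp}.
Variable F : nonlin R d Lm Lp.
Hypothesis F_Q : Qnonlin s hom reg rule F.
Hypothesis F_plantable : plantable rule F.
Variable U : jet R d Lm Lp.
Hypothesis U_Hex : Hex s hom rule U.
Local Notation vtree := (vtree d Lm Lp).
Local Notation Tex := (Tex s hom rule).
Local Notation Tex_at := (Tex_at s hom rule).
Local Notation u := (jetu U).
Implicit Types (t : Lp) (sigma tau : vtree) (L : nat).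

Definition root_driver sigma : driver d Lm Lp := (rdec (val sigma)).1.
Definition root_pow sigma : midx d := (rdec (val sigma)).2.

Definition strip sigma : vtree :=
  vnode (driver0 d Lm Lp) (root_pow sigma) (vkids sigma).

Definition root_deriv t sigma : fn R d Lp :=
  dXpow (root_pow sigma) (pderivs (unzip1 (vkids sigma)) (F t (root_driver sigma))).

Lemma CO_nonlin t l : CO (F t l).
Proof. by case: F_Q => pF _ _; case: (pF t l). Qed.

Lemma nonlin_at_strip t sigma :
  nonlin_at F U t (root_driver sigma) (strip sigma) * (tsym sigma)%:R =
  root_deriv t sigma u *
  \prod_(x <- vkids sigma) (U x.1.1 (planted (x.1.1, 0) x.2) * (tsym x.2)%:R).
Proof.
rewrite tsym_word_fact natrM mulrA /strip -wtree_root_word.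
have cG := CO_nonlin t (root_driver sigma); have [[B GB] _] := cG.
set G := F t (root_driver sigma) in cG GB *.
pose r := rev (midx_seq (root_pow sigma)).
rewrite [_ * (word_fact _)%:R]mulrC -/(wcoef _ (root_word sigma)).
(* The set of coordinates grows once per X letter; the truncation used below is the length of the
   word plus one. *)
have GA : depends_on [set` iter (size r) (@grow d Lp) B] G.
  by apply: depends_sub GB => o /= oB; exact: (fsubsetP (iter_grow_sub _ _)).
rewrite (wcoef_nonlin_at U cG GA (ltnSn _)).
rewrite (taylor_sum_word U cG GB (fsubset_refl _) (ltnSn _)).
rewrite revK -dXpowE -/(root_deriv t sigma) [_ * root_deriv _ _ _]mulrC -mulrA.
by rewrite big_split natr_prod.
Qed.

Lemma unzip1_vkids sigma : unzip1 (vkids sigma) = unzip1 (kids (val sigma)).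
Proof. by rewrite -vkids_val /unzip1 -[RHS]map_comp. Qed.

Lemma upsilonE t sigma : upsilon F t sigma u =
  (\prod_(x <- vkids sigma) upsilon F x.1.1 x.2 u) * root_deriv t sigma u.
Proof.
have kE := vkids_val sigma.
rewrite /root_deriv unzip1_vkids /root_pow /root_driver.
transitivity ((\prod_(x <- kids (val sigma)) upsilon_rec F x.2 x.1.1 u) *
  dXpow (rdec (val sigma)).2
    (pderivs (unzip1 (kids (val sigma))) (F t (rdec (val sigma)).1)) u).
  rewrite /upsilon; case: (val sigma) => -[l k] r /=; congr (_ * _).
  by elim: r => [|x r IH]; rewrite ?big_nil ?big_cons //= IH.
by congr (_ * _); rewrite -kE big_map.
Qed.

Lemma tjoin_strip sigma : tjoin (strip sigma) (Xi (root_driver sigma)) = sigma.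
Proof.
apply: tree_eq.
  rewrite rdec_tjoin !rdec_vnode driver0D addr0.
  by rewrite [RHS]surjective_pairing.
rewrite (perm_trans (kids_tjoin _ _))// kids_vnode0 cats0.
by rewrite -[X in perm_eq _ X]vkids_val; exact: kids_vnode.
Qed.

(** As [f] lives on trees without root driver, the driver of [sigma] must come from [Xi l]; by
    cancellation the first factor is then [strip sigma]. *)
Lemma smul_Xi f l sigma : nodriver_supp f ->
  smul f (deltat R (Xi l)) sigma = if l == root_driver sigma then f (strip sigma) else 0.
Proof.
move=> f0; rewrite /smul; case: eqP => [->|ne].
  rewrite -(@fsbig_widen _ _ _ _ [set (strip sigma, Xi (root_driver sigma))]).
  - by rewrite fsbig_set1 /deltat eqxx mulr1.
  - by move=> _ ->; exact: tjoin_strip.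
  - move=> [x y] [/= xy nxy]; rewrite /deltat; case: eqP => [yE|]; last by rewrite mulr0.
    case: nxy; rewrite yE; congr (_, _); apply: (@tjoinI _ _ _ (Xi (root_driver sigma))).
    by transitivity sigma; [rewrite -[RHS]xy yE tjoinC|rewrite tjoinC tjoin_strip].
apply: fsbig1 => -[x y] /= xy; rewrite /deltat; case: eqP => [yE|]; last by rewrite mulr0.
have [nx|nx] := boolP (nodriver x); last by rewrite f0// mul0r.
case: ne; rewrite /root_driver -xy yE rdec_tjoin (nodriverP nx) driver0D.
by rewrite rdec_vnode.
Qed.

Lemma nonlin_at_0 t l sigma : F t l = (fun=> 0) -> nonlin_at F U t l sigma = 0.
Proof.
move=> F0; rewrite /nonlin_at fsbig1// => alpha _.
by rewrite F0 /Dmulti pderivs_0 !mul0r.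
Qed.

Lemma sum_smul_Xi t sigma :
  \sum_(l \in Dt s hom rule t) smul (nonlin_at F U t l) (deltat R (Xi l)) sigma =
  nonlin_at F U t (root_driver sigma) (strip sigma).
Proof.
have E l : smul (nonlin_at F U t l) (deltat R (Xi l)) sigma =
    if l == root_driver sigma then nonlin_at F U t l (strip sigma) else 0.
  by rewrite smul_Xi//; exact: nonlin_at_supp.
(* The sum may run over all drivers, since [F] vanishes outside [Dt]; a single term then
   survives. *)
rewrite (@fsbig_widen _ _ _ _ _ [set: driver d Lm Lp])//; last first.
  move=> l [_ nl] /=; rewrite E; case: ifP => // _; apply: nonlin_at_0.
  by case: F_Q => _ + _; apply.
rewrite -(@fsbig_widen _ _ _ _ [set root_driver sigma])// ?fsbig_set1 ?E ?eqxx//.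
by move=> l [_ /= ne]; rewrite E; case: eqP.
Qed.

Lemma jet_planted0 t sigma : ~ Tex (planted (t, 0) sigma) -> U t (planted (t, 0) sigma) = 0.
Proof.
move=> nT; apply/eqP/negPn/negP => U0; have [_ /(_ _ U0)] := U_Hex t.
by case=> [[p /esym/Xpow_planted]|[? []]].
Qed.

Lemma jetRE t sigma : jetR s hom rule U t sigma = U t (planted (t, 0) sigma).
Proof.
rewrite /jetR fsum_deltat !tinner_deltar tsym_planted /deltat eqxx mul1r.
rewrite mulfK ?pnatr_eq0 -?lt0n ?tsym_gt0//; case: ifPn => // /negP nT.
by rewrite jet_planted0// => T; apply: nT; rewrite inE.
Qed.

Definition upsilon_jet t sigma : Prop :=
  U t (planted (t, 0) sigma) * (tsym sigma)%:R = upsilon F t sigma u.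

Lemma upsilon_jet_unplanted t sigma : Tex_at (inr t) sigma ->
  ~ Tex (planted (t, 0) sigma) -> upsilon_jet t sigma.
Proof.
move=> Ts nT; rewrite /upsilon_jet jet_planted0// mul0r upsilonE.
have F0 l : F t l = fun=> 0.
  apply: contrapT => Fl; have [|t' rt] := F_plantable (t := t); first by exists l.
  exact: nT (Tex_at_planted rt Ts).
by rewrite /root_deriv F0 pderivs_0 dXpowE dXs_0 mulr0.
Qed.

(** This trades planted trees in [Tex] for [Tex_at], which passes to branches. The edge (t, 0) adds
    one to [Lsize], whence the L+1 in [coherent]. *)
Lemma coherentP L : coherent s hom rule F L U <->
  forall t sigma, Tex_at (inr t) sigma -> (Lsize sigma <= L)%N -> upsilon_jet t sigma.
Proof.
split=> [cU t sigma Ts sL|H t sigma [Ts sL]].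
  have [Tp|] := pselect (Tex (planted (t, 0) sigma)); last exact: upsilon_jet_unplanted.
  rewrite /upsilon_jet -(cU t sigma); last by split => //=; rewrite Lsize_planted.
  by rewrite tinner_deltar tsym_planted.
rewrite tinner_deltar tsym_planted; apply: H; first exact: planted_Tex_at Ts.
by move: sL; rewrite /= Lsize_planted.
Qed.

Lemma tsym_neq0 sigma : (tsym sigma)%:R != 0 :> R.
Proof. by rewrite pnatr_eq0 -lt0n tsym_gt0. Qed.

(** Once the branches are coherent, the product in [nonlin_at_strip] is the one in [upsilonE], and
    the two equations differ by the non-zero factor [tsym sigma]. *)
Lemma upsilon_jet_nonlin t sigma :
  (forall x, x \in vkids sigma -> upsilon_jet x.1.1 x.2) ->
  upsilon_jet t sigma <->
  nonlin_at F U t (root_driver sigma) (strip sigma) = U t (planted (t, 0) sigma).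
Proof.
move=> H; rewrite /upsilon_jet upsilonE -(eq_big_seq _ H) mulrC.
have := nonlin_at_strip t sigma; rewrite [_ * root_deriv _ _ _]mulrC => <-.
split=> [|<-]; last by rewrite mulrC.
by rewrite mulrC => /(mulIf (tsym_neq0 sigma)) ->.
Qed.

(** A non-zero derivative would put the root edges into [Nhat], and [Qnonlin] would make the root
    conform at [t]. *)
Lemma root_deriv_Tex_at t sigma : Tex sigma -> ~ Tex_at (inr t) sigma ->
  root_deriv t sigma = fun=> 0.
Proof.
move=> Ts nT; rewrite /root_deriv (_ : pderivs _ _ = fun=> 0) ?dXpowE ?dXs_0//.
apply: contrapT => nz; apply: nT; apply: Tex_at_Dext => //.
case: F_Q => pF F0 FN.
have Dl : Dt s hom rule t (root_driver sigma).
  by apply: contrapT => nD; apply: nz; rewrite F0// pderivs_0.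
have := FN t _ _ _ (Nhat_pderivs (pF t (root_driver sigma)) nz).
by rewrite unzip1_vkids; apply; exists t.
Qed.

Lemma nonlin_at_unconforming t sigma : Tex sigma -> ~ Tex_at (inr t) sigma ->
  nonlin_at F U t (root_driver sigma) (strip sigma) = U t (planted (t, 0) sigma).
Proof.
move=> Ts nT; rewrite jet_planted0; last by move=> /planted_Tex_at.
apply: (mulIf (tsym_neq0 sigma)).
by rewrite nonlin_at_strip root_deriv_Tex_at// !mul0r.
Qed.

Lemma coherent_nonlin L : coherent s hom rule F L U <->
  forall t sigma, Wtrees s hom rule L sigma ->
    nonlin_at F U t (root_driver sigma) (strip sigma) = U t (planted (t, 0) sigma).
Proof.
rewrite coherentP; split=> H t sigma.
  move=> [Ts sL]; have [Tt|nT] := pselect (Tex_at (inr t) sigma); last first.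
    exact: nonlin_at_unconforming.
  apply/upsilon_jet_nonlin; last exact: H.
  move=> x xs; apply: H; first exact: Tex_at_vkids Tt xs.
  by rewrite (leq_trans _ sL)// ltnW// Lsize_vkids.
(* In this direction coherence of the branches has to be built up by strong induction on [Lsize],
   for all [t] at once as each branch has its own type. *)
have [n] := ubnP (Lsize sigma); elim: n t sigma => // n IH t sigma sn Tt sL.
apply/upsilon_jet_nonlin.
  move=> x xs; have xL := Lsize_vkids xs; apply: IH.
  - by rewrite (leq_trans xL).
  - exact: Tex_at_vkids Tt xs.
  - by rewrite (leq_trans _ sL)// ltnW.
by apply: H; split => //; exact: Tex_at_Tex Tt.
Qed.

End Coherence.

Theorem lemma3p21 (R : realType) (d : nat) (s : 'I_d.+1 -> R)
    (s_ge1 : forall i, 1 <= s i)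
    (Lm Lp : finType) (hom : label Lm Lp -> R)
    (hom_neg : forall l : Lm, hom (inl l) < 0)
    (hom_pos : forall t : Lp, 0 < hom (inr t))
    (reg : option (label Lm Lp) -> R)
    (reg0 : reg None = 0)
    (reg_noise : forall l : Lm, reg (Some (inl l)) < hom (inl l))
    (reg_neq0 : forall o : otype d Lp, rege s reg (etype_of_o Lm o) != 0)
    (rule : label Lm Lp -> set {mset etype d Lm Lp})
    (ruleP : is_rule rule) (rule_normal : normal_rule rule)
    (rule_subcritical : subcritical_rule s hom reg rule)
    (rule_complete : complete_rule s hom rule)
    (F : nonlin R d Lm Lp) (F_Q : Qnonlin s hom reg rule F)
    (F_plantable : plantable rule F)
    (L : nat) (U : jet R d Lm Lp) (U_Hex : Hex s hom rule U) :
  coherent s hom rule F L U <->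
  forall t : Lp,
    ptrunc s hom rule L (fun sigma =>
      \sum_(l \in Dt s hom rule t)
        smul (nonlin_at F U t l) (deltat R (Xi l)) sigma)
    = ptrunc s hom rule L (jetR s hom rule U t).
Proof.
rewrite (coherent_nonlin F_Q F_plantable U_Hex).
split=> [H t|H t sigma Ws].
  apply/funext => sigma; rewrite /ptrunc; case: asboolP => // Ws.
  by rewrite (sum_smul_Xi F_Q) (jetRE U_Hex); exact: H.
have := congr1 (fun f => f sigma) (H t); rewrite /ptrunc asboolT//.
by rewrite (sum_smul_Xi F_Q) (jetRE U_Hex).
Qed.
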